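(* Let $G$ be a topological group and let $X$ be a $G$-ED flow. Then the following are equivalent: (1) $X$ is $G$-finite. (2) For every symmetric open neighborhood $U$ of $e_G$, $X$ can be covered by (finitely many) open $U$-TT sets. (3) $X$ is $G$-discrete. (4) For each symmetric open neighborhood $U$ of $e_G$ and each $x\in X$, $x\in\mathrm{Int}(R_U[x])$. (5) For every set $I$ and every ultrafilter $\mathcal{U}\in\beta I$, the ultracopower map $\pi_{X,\mathcal{U}}\colon\Sigma^G_{\mathcal{U}}X\to X$ is an isomorphism. (6) For each $\sigma\in\mathrm{SN}(G)$, $\partial_\sigma$ is compatible. (7) For some base of semi-norms $\mathcal{B}\subseteq\mathrm{SN}(G)$ and for each $\sigma\in\mathcal{B}$, $\partial_\sigma$ is compatible.
   Context: All topological spaces are Hausdorff and regular. For a topological group $G$, a $G$-space is a topological space with a continuous left $G$-action $G\times X\to X$; a $G$-flow is a compact $G$-space. A $G$-map is a continuous $G$-equivariant map. A $G$-space $X$ is $G$-ED if $\overline{A}\subseteq\mathrm{Int}(\overline{UA})$ for every open $A\subseteq X$ and every neighborhood $U$ of $e_G$. $X$ is $G$-finite if for every symmetric open neighborhood $U$ of $e_G$, every family $\mathcal{F}$ of nonempty open subsets of $X$ such that $\{UA:A\in\mathcal{F}\}$ is pairwise disjoint is finite. A nonempty open $A\subseteq X$ is $U$-TT if $A\subseteq\overline{UB}$ for every nonempty open $B\subseteq A$. For $x\in X$ put $Q_U[x]=\bigcap\{\overline{UA}:A\subseteq X\text{ open},\ x\in\overline{A}\}$ and $R_U[x]=\bigcap\{\overline{UA}:A\text{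 an open neighborhood of }x\}$. A point $x$ is $G$-isolated if $x\in\mathrm{Int}(Q_U[x])$ for every symmetric open neighborhood $U$ of $e_G$; $X$ is $G$-discrete if every point of $X$ is $G$-isolated. $\mathrm{SN}(G)$ is the set of bounded continuous $\sigma\colon G\to[0,\infty)$ with $\sigma(e_G)=0$, $\sigma(g)=\sigma(g^{-1})$, $\sigma(gh)\le\sigma(g)+\sigma(h)$; $\mathrm{B}_\sigma(c)=\{g:\sigma(g)<c\}$. A base of semi-norms is a set $\mathcal{B}\subseteq\mathrm{SN}(G)$ such that $\{\mathrm{B}_\sigma(c):\sigma\in\mathcal{B},c>0\}$ is a neighborhood base at $e_G$. For $x,y\in X$ and $c\in[0,\infty)$, $\partial_\sigma(x,y)\le c$ iff for all $\epsilon>0$ and all open $A\ni x$, $y\in\overline{\mathrm{B}_\sigma(c+\epsilon)\cdot A}$; this defines $\partial_\sigma\colon X^2\to[0,\infty]$, a lower semi-continuous pseudometric when $X$ is $G$-ED. $\partial_\sigma$ is compatible if $x\in\mathrm{Int}(\{z:\partial_\sigma(x,z)<c\})$ for every $x\in X$ and $c>0$. Ultracopowers: for a $G$-ED flow $X$ and a (discrete) set $I$, $I\times X$ is a $G$-space via $g(i,x)=(i,gx)$. Let $\mathrm{S}_G(I\times X)$ be its universal $G$-equivariant compactification: a $G$-flow containing $I\times X$ as a dense $G$-subspace such that every $G$-map from $I\times X$ to a $G$-flow extends to a $G$-map on $\mathrm{S}_G(I\times X)$. The projections extend continuously to $\pi_I\colon\mathrm{S}_G(I\times X)\to\beta I$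 and $\pi_X\colon\mathrm{S}_G(I\times X)\to X$. For $\mathcal{U}\in\beta I$, $\Sigma^G_{\mathcal{U}}X:=\pi_I^{-1}(\{\mathcal{U}\})$ and $\pi_{X,\mathcal{U}}:=\pi_X|_{\Sigma^G_{\mathcal{U}}X}$ is the ultracopower map. *)

(* Defs.v *)
From HB Require Import structures.
From mathcomp Require Import all_boot all_order all_algebra.
From mathcomp Require Import all_classical all_reals all_analysis.
Set Implicit Arguments.
Unset Strict Implicit.
Unset Printing Implicit Defensive.
Import Order.TTheory GRing.Theory Num.Theory numFieldNormedType.Exports.
Local Open Scope classical_set_scope.
Local Open Scope ring_scope.

HB.mixin Record isTopGroup G & Group G & Topological G := {
  mulg_continuous : continuous (fun gh : G * G => (gh.1 * gh.2)%g);
  invg_continuous : continuous (fun g : G => (g^-1)%g)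
}.

#[short(type="topGroupType")]
HB.structure Definition TopGroup :=
  {G of Group G & Topological G & isTopGroup G}.

HB.mixin Record isGSpace (G : topGroupType) X & Topological X := {
  gact : G -> X -> X;
  gact1 : forall x, gact 1%g x = x;
  gactM : forall g h x, gact (g * h)%g x = gact g (gact h x);
  gact_continuous : continuous (fun gx : G * X => gact gx.1 gx.2)
}.

#[short(type="gspaceType")]
HB.structure Definition GSpace (G : topGroupType) :=
  {X of Topological X & isGSpace G X}.

Section ContinuityHelpers.
Context (S T U : topologicalType).

Lemma continuous_pair (f : S -> T) (g : S -> U) :
  continuous f -> continuous g -> continuous (fun x => (f x, g x)).
Proof. by move=> cf cg x; apply: cvg_pair; [exact: cf|exact: cg]. Qed.

Lemma continuous_o (f : S -> T) (g : T -> U) :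
  continuous f -> continuous g -> continuous (fun x => g (f x)).
Proof. by move=> cf cg x; apply: continuous_comp; [exact: cf|exact: cg]. Qed.

Lemma continuous_fst : continuous (@fst S T).
Proof. by move=> x; exact: cvg_fst. Qed.

Lemma continuous_snd : continuous (@snd S T).
Proof. by move=> x; exact: cvg_snd. Qed.

Lemma continuous_const (t : T) : continuous (fun _ : S => t).
Proof. by move=> x; exact: cvg_cst. Qed.

Lemma continuous_idfun : continuous (fun x : S => x).
Proof. by move=> x; exact: cvg_id. Qed.

End ContinuityHelpers.

(* Topological groups and G-spaces carry no separation axiom in their
   structure; the convention that spaces are Hausdorff and regular is imposed
   by this predicate. *)
Definition hausdorff_regular (T : topologicalType) : Prop :=
  hausdorff_space T /\ regular_space T.

Definition flow (G : topGroupType) (X : gspaceType G) : Prop :=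
  hausdorff_regular X /\ compact [set: X].

Definition gmap (G : topGroupType) (X Y : gspaceType G) (f : X -> Y) : Prop :=
  continuous f /\ forall g x, f (gact g x) = gact g (f x).

Definition gisomorphism (G : topGroupType) (X Y : gspaceType G)
    (f : X -> Y) : Prop :=
  gmap f /\ exists h : Y -> X, [/\ gmap h, cancel f h & cancel h f].

Section GSpaceNotions.
Context (G : topGroupType) (X : gspaceType G).
Implicit Types (U : set G) (A B : set X) (x : X).

Definition sym_open_nbhd U : Prop :=
  [/\ open U, U 1%g & forall g, U g -> U (g^-1)%g].

Definition smul U A : set X := [set gact g a | g in U & a in A].

Definition G_ED : Prop :=
  forall A U, open A -> nbhs (1%g : G) U ->
    closure A `<=` (closure (smul U A))°.

(* [trivIset] is indexed by the members of F, so distinct members A, B of F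
   have disjoint translates U A and U B. *)
Definition G_finite : Prop :=
  forall U, sym_open_nbhd U -> forall F : set (set X),
    (forall A, F A -> open A /\ A !=set0) ->
    trivIset F (smul U) -> finite_set F.

Definition TT U A : Prop :=
  [/\ open A, A !=set0 &
      forall B, open B -> B !=set0 -> B `<=` A -> A `<=` closure (smul U B)].

Definition Qset U x : set X :=
  \bigcap_(A in [set A | open A /\ closure A x]) closure (smul U A).

Definition Rset U x : set X :=
  \bigcap_(A in [set A | open A /\ A x]) closure (smul U A).

Definition G_isolated x : Prop :=
  forall U, sym_open_nbhd U -> (Qset U x)° x.

Definition G_discrete : Prop := forall x, G_isolated x.

End GSpaceNotions.

Arguments G_ED {G} X.
Arguments G_finite {G} X.
Arguments G_discrete {G} X.

Section SemiNorms.
Context (R : realType) (G : topGroupType).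

Definition SN : set (G -> R) :=
  [set s : G -> R | [/\ bounded_fun s, continuous s & forall g, 0 <= s g] /\
           [/\ s 1%g = 0, forall g, s g = s (g^-1)%g &
               forall g h, s (g * h)%g <= s g + s h]].

Definition sball (s : G -> R) (c : R) : set G := [set g | s g < c].

Definition seminorm_base (B : set (G -> R)) : Prop :=
  [/\ B `<=` SN,
      forall s c, B s -> 0 < c -> nbhs (1%g : G) (sball s c) &
      forall U, nbhs (1%g : G) U ->
        exists s c, [/\ B s, 0 < c & sball s c `<=` U]].

Context (X : gspaceType G).

Definition sdist_le (s : G -> R) (x y : X) (c : R) : Prop :=
  forall e, 0 < e -> forall A : set X, open A -> A x ->
    closure (smul (sball s (c + e)) A) y.

(* [sdistP] checks that this is the function for which
   [sdist s x y <= c] means [sdist_le s x y c]. *)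
Definition sdist (s : G -> R) (x y : X) : \bar R :=
  ereal_inf [set c%:E | c in [set c : R | 0 <= c /\ sdist_le s x y c]].

Lemma sdistP (s : G -> R) (x y : X) (c : R) : 0 <= c ->
  (sdist s x y <= c%:E)%E <-> sdist_le s x y c.
Proof.
move=> c0; split=> [le_c e e0 A oA Ax|hc]; last first.
  by apply: ereal_inf_lbound; exists c.
have lt_ce : (sdist s x y < (c + e)%:E)%E.
  by apply: le_lt_trans le_c _; rewrite lte_fin ltrDl.
have [_ [c' [c'0 hc'] <-]] := ereal_inf_lt lt_ce; rewrite lte_fin => c'lt.
have d0 : 0 < c + e - c' by rewrite subr_gt0.
by have := hc' _ d0 A oA Ax; rewrite addrC subrK.
Qed.

Definition compatible (s : G -> R) : Prop :=
  forall (x : X) (c : R), 0 < c -> ([set z | (sdist s x z < c%:E)%E])° x.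

End SemiNorms.

Arguments SN : clear implicits.
Arguments sdist {R G X}.
Arguments compatible {R G} X s.

(* The Stone-Cech compactification of the discrete space I: the space of
   ultrafilters on I, with base the sets {u : u contains A} for A in I. *)
Record beta (I : Type) := Beta {
  beta_sets :> set_system I;
  beta_ultra : UltraFilter beta_sets
}.

HB.instance Definition _ (I : Type) := gen_eqMixin (beta I).
HB.instance Definition _ (I : Type) := gen_choiceMixin (beta I).

Lemma beta_eq (I : Type) (u v : beta I) : u `<=` v -> u = v.
Proof.
case: u v => [u Uu] [v Uv] /= uv.
have e : v = u by apply: max_filter.
by move: Uv; rewrite e => Uv; congr Beta; exact: Prop_irrelevance.
Qed.

Section BetaTopology.
Context (I : Type).

Definition beta_basic (A : set I) : set (beta I) := [set u | beta_sets u A].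

Lemma beta_cover : \bigcup_(A in [set: set I]) beta_basic A = setT.
Proof.
apply/seteqP; split=> // u _; exists setT => //.
by have := beta_ultra u; rewrite /beta_basic /= => ?; exact: filterT.
Qed.

Lemma beta_join (A B : set I) (u : beta I) :
  [set: set I] A -> [set: set I] B -> beta_basic A u -> beta_basic B u ->
  exists C, [/\ [set: set I] C, beta_basic C u &
                beta_basic C `<=` beta_basic A `&` beta_basic B].
Proof.
move=> _ _ uA uB; exists (A `&` B); split=> //.
  by have := beta_ultra u => ?; exact: filterI.
by move=> v vAB; have := beta_ultra v => ?; split; apply: filterS vAB => ? [].
Qed.

HB.instance Definition _ :=
  isBaseTopological.Build (beta I) beta_cover beta_join.

Lemma open_beta_basic (A : set I) : open (beta_basic A).
Proof. by exists [set A]; rewrite ?bigcup_set1. Qed.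

Lemma beta_hausdorff : hausdorff_space (beta I).
Proof.
move=> u v cuv; apply: beta_eq => A uA.
have := beta_ultra v => Uv; have [//|vNA] := in_ultra_setVsetC A Uv.
have nu : nbhs u (beta_basic A).
  by apply: open_nbhs_nbhs; split=> //; exact: open_beta_basic.
have nv : nbhs v (beta_basic (~` A)).
  by apply: open_nbhs_nbhs; split=> //; exact: open_beta_basic.
have [w [wA wNA]] := cuv _ _ nu nv; have := beta_ultra w => Uw.
have : beta_sets w set0 by rewrite -(setICr A); exact: filterI.
by move/filter_not_empty.
Qed.

Definition beta_unit (i : I) : beta I :=
  Beta (@principal_filter_ultra I i).

End BetaTopology.

(* The G-space I x X, with I discrete and G acting on the second factor. *)
Section Copies.
Context (G : topGroupType) (I : choiceType) (X : gspaceType G).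

Definition copies : Type := (discrete_topology I * X)%type.

HB.instance Definition _ := Topological.on copies.

Definition copies_act (g : G) (p : copies) : copies := (p.1, gact g p.2).

Lemma copies_act1 (p : copies) : copies_act 1%g p = p.
Proof. by case: p => i x; rewrite /copies_act /= gact1. Qed.

Lemma copies_actM (g h : G) (p : copies) :
  copies_act (g * h)%g p = copies_act g (copies_act h p).
Proof. by rewrite /copies_act /= gactM. Qed.

Lemma copies_act_continuous :
  continuous (fun gp : G * copies => copies_act gp.1 gp.2).
Proof.
apply: (@continuous_pair _ (discrete_topology I) X
  (fun gp : G * copies => gp.2.1) (fun gp => gact gp.1 gp.2.2)).
  apply: (@continuous_o _ copies (discrete_topology I)).
    exact: continuous_snd.
  exact: continuous_fst.
apply: (@continuous_o _ (G * X)%type X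
  (fun gp : G * copies => (gp.1, gp.2.2)) (fun gx => gact gx.1 gx.2)).
  apply: continuous_pair; first exact: continuous_fst.
  apply: (@continuous_o _ copies X); first exact: continuous_snd.
  exact: continuous_snd.
exact: gact_continuous.
Qed.

HB.instance Definition _ := isGSpace.Build G copies
  copies_act1 copies_actM copies_act_continuous.

End Copies.

Definition topological_embedding (S T : topologicalType) (f : S -> T) : Prop :=
  injective f /\ @open S = [set f @^-1` B | B in @open T].

(* emb exhibits S as the universal G-equivariant compactification of Z, which
   is determined by these conditions up to a unique isomorphism under Z. *)
Definition universal_compactification (G : topGroupType) (Z S : gspaceType G)
    (emb : Z -> S) : Prop :=
  [/\ flow S, gmap emb, topological_embedding emb, dense (range emb) &
      forall (Y : gspaceType G) (f : Z -> Y), flow Y -> gmap f ->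
        exists2 h : S -> Y, gmap h & h \o emb = f].

(* S_G(I x X), with the continuous extensions to it of the two projections
   (unique, because I x X is dense and beta I and X are Hausdorff). *)
Record SG_copies (G : topGroupType) (I : choiceType) (X : gspaceType G) := {
  SG_space :> gspaceType G;
  SG_emb : copies I X -> SG_space;
  SG_universal : universal_compactification SG_emb;
  SG_projI : SG_space -> beta I;
  SG_projI_continuous : continuous SG_projI;
  SG_projIE : forall p, SG_projI (SG_emb p) = beta_unit p.1;
  SG_projX : SG_space -> X;
  SG_projX_continuous : continuous SG_projX;
  SG_projXE : forall p, SG_projX (SG_emb p) = p.2
}.

Section Ultracopower.
Context (G : topGroupType) (I : choiceType) (X : gspaceType G).
Context (S : SG_copies I X) (u : beta I).

Lemma gact_cts (Y : gspaceType G) (g : G) : continuous (@gact G Y g).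
Proof.
apply: (@continuous_o _ (G * Y)%type Y
  (fun y => (g, y)) (fun gx => gact gx.1 gx.2)).
  apply: continuous_pair; first exact: continuous_const.
  exact: continuous_idfun.
exact: gact_continuous.
Qed.

Lemma SG_projI_act (g : G) (z : S) : SG_projI (gact g z) = SG_projI z.
Proof.
apply: beta_hausdorff => A B nA nB.
have [_ [_ actE] _ dS _] := SG_universal S.
have cA : nbhs z ((fun t => SG_projI (gact g t)) @^-1` A).
  exact: (@gact_cts S g z _ (@SG_projI_continuous _ _ _ S _ _ nA)).
have cB : nbhs z (@SG_projI _ _ _ S @^-1` B).
  exact: (@SG_projI_continuous _ _ _ S _ _ nB).
have := @filterI _ (nbhs z) (nbhs_filter z) _ _ cA cB; rewrite nbhsE => -[W [oW Wz] WAB].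
have W0 : W !=set0 by exists z.
have [y [/WAB /= [hA hB] [p _ pE]]] := dS _ W0 oW.
exists (SG_projI (@SG_emb _ _ _ S p)); split; last by rewrite pE.
by move: hA; rewrite -pE -actE !SG_projIE.
Qed.

Definition ultracopower_set : set S := [set z | SG_projI z = u].

(* the fibre of SG_projI over u, with the subspace topology *)
Definition ultracopower : Type := set_type ultracopower_set.

HB.instance Definition _ := Topological.on ultracopower.

Lemma ultracopower_act_subproof (g : G) (z : ultracopower) :
  gact g (set_val z) \in ultracopower_set.
Proof.
apply/mem_set; rewrite /ultracopower_set /= SG_projI_act.
exact: (set_mem (valP z)).
Qed.

Definition ultracopower_act (g : G) (z : ultracopower) : ultracopower :=
  SigSub (ultracopower_act_subproof g z).

Lemma ultracopower_act1 (z : ultracopower) : ultracopower_act 1%g z = z.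
Proof. by apply: val_inj; rewrite /= gact1. Qed.

Lemma ultracopower_actM (g h : G) (z : ultracopower) :
  ultracopower_act (g * h)%g z = ultracopower_act g (ultracopower_act h z).
Proof. by apply: val_inj; rewrite /= gactM. Qed.

Lemma ultracopower_act_continuous :
  continuous (fun gz : G * ultracopower => ultracopower_act gz.1 gz.2).
Proof.
apply: continuous_comp_initial.
apply: (@continuous_o _ (G * S)%type S
  (fun gz : G * ultracopower => (gz.1, set_val gz.2))
  (fun gx => gact gx.1 gx.2)).
  apply: continuous_pair; first exact: continuous_fst.
  apply: (@continuous_o _ ultracopower S); first exact: continuous_snd.
  exact: initial_continuous.
exact: gact_continuous.
Qed.

HB.instance Definition _ := isGSpace.Build G ultracopower
  ultracopower_act1 ultracopower_actM ultracopower_act_continuous.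

Definition ultracopower_map (z : ultracopower) : X := SG_projX (set_val z).

End Ultracopower.

(* Main.v *)
Require Import Defs.
From HB Require Import structures.
From mathcomp Require Import all_boot all_order all_algebra.
From mathcomp Require Import all_classical all_reals all_analysis.
Import Order.TTheory GRing.Theory Num.Theory numFieldNormedType.Exports.
Local Open Scope classical_set_scope.
Local Open Scope ring_scope.

Set Implicit Arguments.
Unset Strict Implicit.
Unset Printing Implicit Defensive.

(** All the conditions but the one on ultracopowers are compared by elementary
    arguments, of which one carries most of the weight. In a G-ED space, if a
    point [x] lies in the closures of both [VA] and [VB] for open [A], [B], then
    the closure of [VA] thickens to a neighborhood of [x], so [VVA] meets [VB]
    ([G_ED_meet]). An open set that meets [R_V[x]] has [x] in the closure of its
    [V]-translate ([Rset_closure]). So two open sets meeting the same [R_V[x]]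
    cannot have disjoint [U]-translates when [V^2] is contained in [U]
    ([G_ED_Rset_meet]). If every [R_V[x]] is a neighborhood of [x], finitely
    many of them cover the compact space [X], which bounds the families of open
    sets with disjoint translates: [X] is G-finite. Conversely a G-finite space
    contains [U]-TT sets inside every open set, and a maximal family of them
    with disjoint translates thickens to a finite cover by [U]-TT sets. A TT set
    around [x] is contained in [Q_U[x]], hence G-discreteness, and [Q_U[x]] is
    contained in [R_U[x]]. The sets [R_U[x]] for [U] a ball of a semi-norm [s]
    are, up to the choice of the radius, the balls of [sdist s], which gives the
    conditions on compatibility; that a base of semi-norms exists at all is the
    Birkhoff-Kakutani theorem ([SN_seminorm_base]).

    Let every [R_U[x]] be a neighborhood of [x]. Two distinct points of an
    ultracopower over the same [x] have neighborhoods with disjoint translates.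
    Their traces on some copy of [X] are open sets which both meet [R_V[x]],
    against the fact above ([Rset_nbhd_ultracopower_inj]). The ultracopower map
    is onto since limits of constant families exist, and it is a homeomorphism
    by compactness.

    If all ultracopower maps are isomorphisms, then [X] is G-finite, and for
    this the universal compactification of countably many copies of [X] has to
    be constructed: it is the closure of the image of the copies in the cube of
    all functions to the unit interval that are uniformly continuous for the
    action ([universal_compactification_separated]). If [X] is not G-finite
    there are infinitely many open sets [A_n] with disjoint translates. In a
    G-ED space the function [y |-> inf {r : y in the closure of B_s(r) A_n}] is
    continuous and moves by at most [s g] under [g]
    ([thickening_dist_continuous], [thickening_dist_act]), so these functions
    together form a coordinate of the compactification. It separates the limit
    of points [(n, x_n)] with [x_n] in [A_n] from the limit of the points
    [(n, x)] over the same [x] ([ultracopower_inj_G_finite]). *)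

(** * Preliminaries in topology *)

Lemma closed_set1_hausdorff (T : topologicalType) (t : T) :
  hausdorff_space T -> closed [set t].
Proof.
by move=> hT; apply: accessible_closed_set1; exact: hausdorff_accessible.
Qed.

Lemma open_preimage (S T : topologicalType) (f : S -> T) (B : set T) :
  continuous f -> open B -> open (f @^-1` B).
Proof. by move=> cf oB; exact: (continuousP f).1. Qed.

Lemma closed_preimage (S T : topologicalType) (f : S -> T) (B : set T) :
  continuous f -> closed B -> closed (f @^-1` B).
Proof. by move=> cf clB; exact: (continuous_closedP f).1. Qed.

(** * Translates by neighborhoods of the identity *)

Section TopGroupFacts.
Context {G : topGroupType}.
Implicit Types U V W : set G.

Lemma sym_open_nbhd_nbhs U : sym_open_nbhd U -> nbhs 1%g U.
Proof. by case=> oU U1 _; exact: open_nbhs_nbhs. Qed.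

Lemma continuous_mulgl (g : G) : continuous (fun h : G => (g * h)%g).
Proof.
apply: (@continuous_o _ _ _ (fun h : G => (g, h)) (fun p => (p.1 * p.2)%g)).
  by apply: continuous_pair; [exact: continuous_const|exact: continuous_idfun].
exact: mulg_continuous.
Qed.

Lemma continuous_mulgr (g : G) : continuous (fun h : G => (h * g)%g).
Proof.
apply: (@continuous_o _ _ _ (fun h : G => (h, g)) (fun p => (p.1 * p.2)%g)).
  by apply: continuous_pair; [exact: continuous_idfun|exact: continuous_const].
exact: mulg_continuous.
Qed.

Lemma exists_sym_open_nbhd U : nbhs 1%g U ->
  exists2 V, sym_open_nbhd V & V `<=` U.
Proof.
move=> nU; exists (U° `&` (fun g => (g^-1)%g) @^-1` U°); last first.
  by move=> g [+ _]; exact: interior_subset.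
split; last by move=> g [Ug Ug1]; split => //=; rewrite invgK.
- apply: openI; first exact: open_interior.
  apply: open_preimage; last exact: open_interior.
  exact: invg_continuous.
- by split=> //=; rewrite invg1.
Qed.

Lemma exists_square_root_nbhd U : nbhs 1%g U ->
  exists2 V, sym_open_nbhd V & forall g h, V g -> V h -> U (g * h)%g.
Proof.
move=> nU; have := @mulg_continuous G (1%g, 1%g) U; rewrite /= mulg1.
move=> /(_ nU) [[A B] /= [nA nB] sAB].
have [V sV VAB] := exists_sym_open_nbhd (filterI nA nB).
by exists V => // g h /VAB[Ag _] /VAB[_ Bh]; exact: (sAB (g, h)).
Qed.

Lemma nbhs_conjg U (g : G) : nbhs 1%g U ->
  nbhs 1%g [set h | U (g * h * g^-1)%g].
Proof.
move=> nU; have : continuous (fun h : G => (g * h * g^-1)%g).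
  apply: (@continuous_o _ _ _ (fun h => (g * h)%g) (fun h => (h * g^-1)%g)).
    exact: continuous_mulgl.
  exact: continuous_mulgr.
by move=> /(_ 1%g U); rewrite /= mulg1 mulgV; exact.
Qed.

End TopGroupFacts.

Section Translates.
Context {G : topGroupType} {X : gspaceType G}.
Implicit Types (U V W : set G) (A B : set X) (x y : X).

Lemma gactK (g : G) x : gact (g^-1)%g (gact g x) = x.
Proof. by rewrite -gactM mulVg gact1. Qed.

Lemma gactVK (g : G) x : gact g (gact (g^-1)%g x) = x.
Proof. by rewrite -gactM mulgV gact1. Qed.

Lemma open_smul U A : open A -> open (smul U A).
Proof.
move=> oA; have -> : smul U A = \bigcup_(g in U) (gact (g^-1)%g @^-1` A).
  apply/seteqP; split=> [_ [g Ug [a Aa <-]]|x [g Ug Ax]].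
    by exists g => //=; rewrite gactK.
  by exists g => //; exists (gact g^-1%g x) => //; rewrite gactVK.
apply: bigcup_open => g _; apply: open_comp => // x _.
exact: gact_cts.
Qed.

Lemma smulS U V A B : U `<=` V -> A `<=` B -> smul U A `<=` smul V B.
Proof.
by move=> UV AB _ [g /UV Vg [a /AB Ba <-]]; exists g => //; exists a.
Qed.

Lemma subset_smul U A : U 1%g -> A `<=` smul U A.
Proof. by move=> U1 x Ax; exists 1%g => //; exists x; rewrite ?gact1. Qed.

Lemma smul_smul U V W A : (forall g h, U g -> V h -> W (g * h)%g) ->
  smul U (smul V A) `<=` smul W A.
Proof.
move=> UVW _ [g Ug [_ [h Vh [a Aa <-]] <-]].
by exists (g * h)%g; [exact: UVW|exists a => //; rewrite gactM].
Qed.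

Lemma smul_closure U A : smul U (closure A) `<=` closure (smul U A).
Proof.
move=> _ [g Ug [x clx <-]] N nN.
have /clx[a [Aa Na]] : nbhs x (gact g @^-1` N) by exact: gact_cts.
by exists (gact g a); split => //; exists g => //; exists a.
Qed.

(** Symmetry of [V] lets a translation be moved across an intersection. *)
Lemma smul_meet V A B : (forall g, V g -> V (g^-1)%g) ->
  smul V A `&` B !=set0 -> A `&` smul V B !=set0.
Proof.
move=> symV [_ [[g Vg [a Aa <-]] Bga]]; exists a; split=> //.
by exists (g^-1)%g; [exact: symV|exists (gact g a) => //; rewrite gactK].
Qed.

Lemma closure_open_meet (T : topologicalType) (C D : set T) (t : T) :
  closure C t -> open D -> D t -> C `&` D !=set0.
Proof. by move=> clC oD Dt; apply: clC; exact: open_nbhs_nbhs. Qed.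

(** If two open sets have a common point in the closures of their translates,
   then [G_ED] thickens one of the closures to a neighborhood of that point. *)
Lemma G_ED_meet V A B x : G_ED X -> sym_open_nbhd V -> open A -> open B ->
  closure (smul V A) x -> closure (smul V B) x ->
  smul V (smul V A) `&` smul V B !=set0.
Proof.
move=> edX sV oA oB clA clB.
have := edX _ _ (open_smul V oA) (sym_open_nbhd_nbhs sV) _ clA.
move=> /clB[y [VBy clVVAy]].
exact: (closure_open_meet clVVAy (open_smul _ oB) VBy).
Qed.

(** Translates are moved across: [y] in the closure of [VC] means that [A] meets
    [VC], so that [VA] meets [C], for every open [C] around [x]. *)
Lemma Rset_closure V A x y : sym_open_nbhd V -> open A -> A y -> Rset V x y ->
  closure (smul V A) x.
Proof.
move=> [_ _ symV] oA Ay Ry N; rewrite nbhsE => -[C [oC Cx] CN].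
have clC : closure (smul V C) y by exact: Ry.
have [c [Cc VAc]] := smul_meet symV (closure_open_meet clC oA Ay).
by exists c; split => //; exact: CN.
Qed.

Lemma G_ED_Rset_meet U V A B x y z : G_ED X -> sym_open_nbhd V ->
  (forall g h, V g -> V h -> U (g * h)%g) -> open A -> open B ->
  A y -> Rset V x y -> B z -> Rset V x z -> smul U A `&` smul U B !=set0.
Proof.
move=> edX sV VVU oA oB Ay Ry Bz Rz.
have [w [VVAw VBw]] := G_ED_meet edX sV oA oB (Rset_closure sV oA Ay Ry)
  (Rset_closure sV oB Bz Rz).
exists w; split; first exact: smul_smul VVAw.
have V1 : V 1%g by case: sV.
by apply: smulS VBw => // g Vg; rewrite -(mulg1 g); exact: VVU.
Qed.

End Translates.

(** * G-finiteness, TT sets and the sets [R_U[x]] *)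

(** Near covering, applied to the filter generated by the finite sets containing
    a given one, gives a finite subcover without a base point in [T]. *)
Lemma compact_finite_subcover (T : topologicalType) (O : T -> set T) :
  compact [set: T] -> (forall x, open (O x)) -> (forall x, O x x) ->
  exists2 D : set T, finite_set D & \bigcup_(x in D) O x = setT.
Proof.
move=> /compact_near_coveringP cT oO Ox.
pose F : set_system (set T) := [set P | exists2 D0, finite_set D0 &
  forall D, finite_set D -> D0 `<=` D -> P D].
have FF : Filter F.
  split; first by exists set0.
    move=> P Q [D fD DP] [E fE EQ]; exists (D `|` E).
      by rewrite finite_setU.
    by move=> H fH DEH; split; [apply: DP|apply: EQ] => // t ?; apply: DEH;
      [left|right].
  by move=> P Q PQ [D fD DP]; exists D => // E fE /(DP _ fE); exact: PQ.
have [x _|D fD cD] := cT _ F (fun D t => exists2 y, D y & O y t) FF.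
  exists (O x, [set D | D x]) => /=.
    split; first exact: open_nbhs_nbhs.
    by exists [set x] => // D _ /(_ x erefl).
  by move=> [t D] /= [Oxt Dx]; exists x.
exists D => //; apply/seteqP; split=> // t _.
by have [y Dy Oyt] := cD D fD (@subset_refl _ D) t I; exists y.
Qed.

Section Conditions.
Context {G : topGroupType} {X : gspaceType G}.
Implicit Types (U V W : set G) (A B : set X) (x y : X).

Lemma G_finite_no_sequence U (A : nat -> set X) : G_finite X ->
  sym_open_nbhd U -> (forall n, open (A n) /\ A n !=set0) ->
  ~ (forall m n, (m < n)%N -> smul U (A m) `&` smul U (A n) = set0).
Proof.
move=> finX sU oA dA.
have U1 : U 1%g by case: sU.
have dis m n y : m != n -> smul U (A m) y -> smul U (A n) y -> False.
  rewrite neq_ltn => /orP[] mn Am An.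
    by rewrite -[False]/(set0 y) -(dA _ _ mn).
  by rewrite -[False]/(set0 y) -(dA _ _ mn).
have injA : injective A.
  move=> m n Amn; apply/eqP/negP => /negP mn.
  have [_ [y Ay]] := oA m.
  by apply: (dis m n y mn); apply: subset_smul => //; rewrite -Amn.
have : finite_set (range A).
  apply: (finX U sU) => [_ [n _ <-]|_ _ [m _ <-] [n _ <-] [y [Am An]]].
    exact: oA.
  by apply/eqP; case: (eqVneq m n) => [->//|mn]; case: (dis m n y mn).
move=> /(finite_preimage (f := A)) finA; apply: infinite_nat.
rewrite -(_ : A @^-1` range A = setT); first by apply: finA => m n _ _ /injA.
by apply/seteqP; split=> // n _; exists n.
Qed.


(** If no open subset of [A] is [U]-TT, one splits off from [A] forever pieces
    with disjoint translates: failure of [U]-TT for [C] gives an open [B] in [C]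
    whose thickening misses an open part [C'] of [C], and [C'] is split next. *)
Lemma G_finite_exists_TT U A : G_finite X -> sym_open_nbhd U ->
  open A -> A !=set0 -> exists2 B, TT U B & B `<=` A.
Proof.
move=> finX sU oA A0; apply: contrapT => noTT.
have [V sV VVU] := exists_square_root_nbhd (sym_open_nbhd_nbhs sU).
have symV : forall g, V g -> V (g^-1)%g by case: sV.
pose good (C : set X) := [/\ open C, C !=set0 & C `<=` A].
have split_ex (C : set X) : exists p : set X * set X, good C ->
    [/\ good p.1, good p.2, p.1 `<=` C, p.2 `<=` C &
        smul V p.1 `&` smul V p.2 = set0].
  have [gC|] := pselect (good C); last by exists (C, C).
  have [oC C0 CA] := gC.
  have [B [oB B0 BC] nCB] : exists2 B, [/\ open B, B !=set0 & B `<=` C] &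
      ~ C `<=` closure (smul U B).
    apply: contrapT => TTC; apply: noTT; exists C => //; split => // B oB B0 BC.
    by apply: contrapT => nCB; apply: TTC; exists B.
  exists (B, C `\` closure (smul U B)) => _ /=; split=> //.
  - by split=> // x /BC /CA.
  - split; last by move=> x [/CA].
      by apply: openI => //; apply: closed_openC; exact: closed_closure.
    by apply: contrapT => C'0; apply: nCB => x Cx; apply: contrapT => nUB;
      apply: C'0; exists x.
  - apply/seteqP; split=> // x VBC'.
    have VBC'0 : smul V B `&` smul V (C `\` closure (smul U B)) !=set0.
      by exists x.
    have [_ [[g Vg [b VBb <-]] [_ []]]] : smul V (smul V B) `&`
        (C `\` closure (smul U B)) !=set0.
      rewrite setIC; apply: (smul_meet symV); rewrite setIC.
      exact: VBC'0.
    apply: subset_closure; apply: (smul_smul VVU).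
    by exists g => //; exists b.
have [f fP] := choice split_ex.
pose C n := iter n (fun C => (f C).2) A.
have gC n : good (C n) by elim: n => [|n /fP[]//]; split.
have CS m n : (m <= n)%N -> C n `<=` C m.
  elim: n => [|n IH]; first by rewrite leqn0 => /eqP ->.
  rewrite leq_eqVlt => /predU1P[->//|/ltnSE/IH].
  by apply: subset_trans; have [_ _ _] := fP _ (gC n).
apply: (@G_finite_no_sequence V (fun n => (f (C n)).1) finX sV) => [n|m n mn].
  by have [[? ? _]] := fP _ (gC n).
have [_ _ _ _ dis] := fP _ (gC m).
apply/seteqP; split=> // y [Vm Vn]; rewrite -dis; split=> //.
apply: smulS Vn => //; apply: subset_trans (CS m.+1 n mn).
by have [_ _] := fP _ (gC n).
Qed.

(** An open [B] in the interior meets [W A], so [W B] meets [A], and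
    the [T]-TT property makes [A] lie in the closure of [T W B]. *)
Lemma TT_interior_closure T W W2 U A : sym_open_nbhd W ->
  (forall g h, T g -> W h -> W2 (g * h)%g) ->
  (forall g h, W g -> W2 h -> U (g * h)%g) -> TT T A ->
  TT U (closure (smul W A))°.
Proof.
move=> sW TWW2 WW2U [oA A0 TTA].
have [_ W1 symW] := sW.
split=> [||B oB [b Bb] BO]; first exact: open_interior.
  have [a Aa] := A0; exists a.
  have : smul W A `<=` (closure (smul W A))°.
    by rewrite -open_subsetE; [exact: subset_closure|exact: open_smul].
  by apply; exact: subset_smul.
have /interior_subset clb : (closure (smul W A))° b by exact: BO.
have meet : A `&` smul W B !=set0.
  by apply: smul_meet symW _; exact: (closure_open_meet clb oB Bb).
have ATWB : A `<=` closure (smul T (smul W B)).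
  apply: subset_trans (TTA _ (openI oA (open_smul _ oB)) meet (@subIsetl _ _ _)) _.
  by apply: closureS; apply: smulS => // ? [].
apply: subset_trans (@interior_subset _ _) _.
have -> : closure (smul U B) = closure (closure (smul U B)).
  by apply/closure_id; exact: closed_closure.
apply: closureS; apply: subset_trans (smulS (@subset_refl _ W) ATWB) _.
apply: subset_trans (@smul_closure _ _ _ _) _; apply: closureS.
apply: subset_trans (smulS (@subset_refl _ W) (smul_smul TWW2)) _.
exact: smul_smul.
Qed.

(** A maximal family of TT sets with disjoint translates is finite, and by
    maximality its thickenings are dense, so their closures cover [X]; [G_ED]
    replaces these closures by open sets. *)
Lemma G_finite_TT_cover U : G_finite X -> G_ED X -> sym_open_nbhd U ->
  exists F : set (set X), [/\ finite_set F, forall A, F A -> TT U A &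
    \bigcup_(A in F) A = [set: X]].
Proof.
move=> finX edX sU.
have [W2 sW2 W2W2U] := exists_square_root_nbhd (sym_open_nbhd_nbhs sU).
have [W sW WWW2] := exists_square_root_nbhd (sym_open_nbhd_nbhs sW2).
have [V sV VVW] := exists_square_root_nbhd (sym_open_nbhd_nbhs sW).
have [T sT TTV] := exists_square_root_nbhd (sym_open_nbhd_nbhs sV).
have [_ W1 _] := sW; have [_ V1 _] := sV; have [_ T1 symT] := sT.
have TW : T `<=` W.
  move=> g Tg; rewrite -(mulg1 g); apply: VVW => //.
  by rewrite -(mulg1 g); apply: TTV.
have WW2 : W `<=` W2 by move=> g Wg; rewrite -(mulg1 g); apply: WWW2.
pose P (F : set (set X)) := (forall A, F A -> TT T A) /\ trivIset F (smul T).
have [F' F'P|F [[FTT trivF] maxF]] := @Zorn_bigcup _ P.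
  move=> tot; split=> [A [F0 /F'P[+ _]]|]; first exact.
  move=> A B [F0 F'0 F0A] [F1 F'1 F1B].
  have [F01|F10] := tot _ _ F'0 F'1.
    by have [_] := F'P _ F'1; apply => //; exact: F01.
  by have [_] := F'P _ F'0; apply => //; exact: F10.
have finF : finite_set F.
  by apply: (finX T sT F) => // A /FTT[].
have dense_VF B : open B -> B !=set0 -> exists2 A, F A & smul V A `&` B !=set0.
  move=> oB B0; have [C TTC CB] := G_finite_exists_TT finX sT oB B0.
  have [oC [c Cc] _] := TTC.
  suff [A FA TCTA] : exists2 A, F A & smul T C `&` smul T A !=set0.
    exists A => //; have [d [Cd TTAd]] := smul_meet symT TCTA.
    by exists d; split; [exact: smul_smul TTAd|exact: CB].
  have [FC|nFC] := pselect (F C).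
    by exists C => //; exists c; split; exact: subset_smul.
  apply: contrapT => noA; apply: (maxF (F `|` [set C])).
    split; first by move=> A FA; left.
    by move=> sub; apply: nFC; apply: sub; right.
  split=> [A [/FTT//|->//]|A B' [FA|->] [FB|->] AB //].
  - exact: trivF.
  - by exfalso; apply: noA; exists A => //; rewrite setIC.
  - by exfalso; apply: noA; exists B'.
exists [set (closure (smul W A))° | A in F]; split.
- exact: finite_image.
- move=> _ [A /FTT TTA <-]; apply: (TT_interior_closure sW _ _ TTA).
    by move=> g h /TW; exact: WWW2.
  by move=> g h /WW2; exact: W2W2U.
apply/seteqP; split=> // x _.
have clU : closed (\bigcup_(A in F) closure (smul V A)).
  by apply: closed_bigcup => // A _; exact: closed_closure.
have [A FA clx] : (\bigcup_(A in F) closure (smul V A)) x.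
  apply: contrapT => nx.
  have [|A FA [y [VAy]]] := dense_VF _ (closed_openC clU); first by exists x.
  by apply; exists A => //; exact: subset_closure.
exists (closure (smul W A))°; first by exists A.
have [oA _ _] := FTT A FA.
apply: interiorS (edX _ _ (open_smul _ oA) (sym_open_nbhd_nbhs sV) _ clx).
by apply: closureS; exact: smul_smul.
Qed.

(** A TT set [A] around [x] lies in [Q_U[x]]: an open [B] with [x] in its closure
    meets [A], and the translate of this intersection is dense in [A]. *)
Lemma TT_cover_G_discrete : (forall U, sym_open_nbhd U ->
    exists F : set (set X), [/\ finite_set F, forall A, F A -> TT U A &
    \bigcup_(A in F) A = [set: X]]) -> G_discrete X.
Proof.
move=> cover x U sU; have [F [_ FTT cF]] := cover U sU.
have [A FA Ax] : (\bigcup_(A in F) A) x by rewrite cF.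
have [oA _ TTA] := FTT A FA.
rewrite /interior nbhsE; exists A; first by split.
move=> y Ay B [oB clB].
have := TTA (B `&` A) (openI oB oA) (closure_open_meet clB oA Ax).
move=> /(_ (@subIsetr _ _ _) y Ay).
by apply: closureS; apply: smulS => // z [].
Qed.

Lemma Qset_Rset U x : Qset U x `<=` Rset U x.
Proof.
by move=> y Qy A [oA Ax]; apply: Qy; split => //; exact: subset_closure.
Qed.

Definition Rset_nbhd : Prop :=
  forall U x, sym_open_nbhd U -> (Rset U x)° x.

Lemma G_discrete_Rset_nbhd : G_discrete X -> Rset_nbhd.
Proof. by move=> dX U x sU; apply: interiorS (dX x U sU); exact: Qset_Rset. Qed.

(** Cover [X] by finitely many sets [R_V[x]]: by [G_ED], two open sets meeting
    the same [R_V[x]] have meeting translates. *)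
Lemma Rset_nbhd_G_finite :
  compact [set: X] -> G_ED X -> Rset_nbhd -> G_finite X.
Proof.
move=> cX edX RX U sU F oF trivF.
have [V sV VVU] := exists_square_root_nbhd (sym_open_nbhd_nbhs sU).
have [D finD cD] := compact_finite_subcover cX
  (fun x => @open_interior _ (Rset V x)) (fun x => RX V x sV).
apply: (@sub_finite_set _ _
    (\bigcup_(x in D) [set A | F A /\ A `&` Rset V x !=set0])).
  move=> A FA; have [_ [y Ay]] := oF A FA.
  have [x Dx /interior_subset Rxy] : (\bigcup_(x in D) (Rset V x)°) y.
    by rewrite cD.
  by exists x => //; split=> //; exists y.
apply: bigcup_finite => // x _.
have [->|/set0P[A [FA [a [Aa Ra]]]]] :=
  eqVneq [set A | F A /\ A `&` Rset V x !=set0] set0; first exact: finite_set0.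
apply: (@sub_finite_set _ _ [set A]); last exact: finite_set1.
move=> B [FB [b [Bb Rb]]] /=; apply: (trivF _ _ FB FA).
have [oA _] := oF A FA; have [oB _] := oF B FB.
exact: (G_ED_Rset_meet edX sV VVU oB oA Bb Rb Aa Ra).
Qed.

End Conditions.

(** * Compatibility of the distances of semi-norms *)

Section SemiNormFacts.
Context {R : realType} {G : topGroupType}.
Implicit Types (s : G -> R).

Lemma sball_sym_open_nbhd s c : SN R G s -> 0 < c -> sym_open_nbhd (sball s c).
Proof.
move=> [[_ cs _] [s1 sV _]] c0; split.
- exact: (open_preimage cs (@open_lt R c)).
- by rewrite /sball /= s1.
- by move=> g; rewrite /sball /= -sV.
Qed.

Context {X : gspaceType G}.

Lemma Rset_nbhd_compatible s : @Rset_nbhd G X -> SN R G s -> compatible X s.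
Proof.
move=> RX sN x c c0; have c20 : 0 < c / 2 by rewrite divr_gt0.
apply: interiorS (RX _ x (sball_sym_open_nbhd sN c20)) => y Ry /=.
have le_c2 : (sdist s x y <= (c / 2)%:E)%E.
  apply/sdistP; first exact: ltW.
  move=> e e0 A oA Ax; have := Ry A (conj oA Ax); apply: closureS.
  by apply: smulS => // g /= /lt_trans; apply; rewrite ltrDl.
apply: le_lt_trans le_c2 _; rewrite lte_fin ltr_pdivrMr // ltr_pMr //.
by rewrite ltr1n.
Qed.

Lemma compatible_Rset_nbhd (B : set (G -> R)) : seminorm_base B ->
  (forall s, B s -> compatible X s) -> @Rset_nbhd G X.
Proof.
move=> [_ _ baseB] compB U x sU.
have [s [c [Bs c0 scU]]] := baseB U (sym_open_nbhd_nbhs sU).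
apply: interiorS (compB s Bs x c c0) => y /= xy_c A [oA Ax].
have [_ [d [d0 xy_d] <-]] := ereal_inf_lt xy_c; rewrite lte_fin => dc.
have cd0 : 0 < c - d by rewrite subr_gt0.
have := xy_d _ cd0 A oA Ax; rewrite addrC subrK.
by apply: closureS; exact: smulS.
Qed.

End SemiNormFacts.

(** * Semi-norms generate the topology of a group *)

(** The least parameter at which an increasing family of sets reaches a point,
    truncated at [1] so that every point is reached. *)
Section ReachingParameter.
Context {R : realType} {T : Type}.
Context (K : R -> set T).

Definition reaching (t : T) : set R := [set r | 0 < r /\ (1 <= r \/ K r t)].

Definition reach (t : T) : R := inf (reaching t).

Lemma reaching_lb t : lbound (reaching t) 0.
Proof. by move=> r [r0 _]; exact: ltW. Qed.

Lemma reaching_neq0 t : reaching t !=set0.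
Proof. by exists 1; split => //; left. Qed.

Lemma reach_le t r : reaching t r -> reach t <= r.
Proof. by apply: ge_inf; exists 0; exact: reaching_lb. Qed.

Lemma reach_ge0 t : 0 <= reach t.
Proof. by apply: lb_le_inf; [exact: reaching_neq0|exact: reaching_lb]. Qed.

Lemma reach_le1 t : reach t <= 1.
Proof. by apply: reach_le; split => //; left. Qed.

Lemma reach_lt t c : reach t < c -> exists2 r, reaching t r & r < c.
Proof.
move=> tc; have [||r Sr rc] := @inf_adherent R (reaching t) (c - reach t).
- by rewrite subr_gt0.
- by split; [exact: reaching_neq0|exists 0; exact: reaching_lb].
by exists r => //; move: rc; rewrite addrC subrK.
Qed.

Lemma reach_eq0 t : (forall r, 0 < r -> K r t) -> reach t = 0.
Proof.
move=> Kt; apply/eqP; rewrite eq_le reach_ge0 andbT; apply/ler_addgt0Pr => e e0.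
by rewrite add0r; apply: reach_le; split => //; right; exact: Kt.
Qed.

Lemma le_reach t r : (forall r' r'', r' < r'' -> K r' `<=` K r'') ->
  r <= 1 -> ~ K r t -> r <= reach t.
Proof.
move=> Kmono r1 nKr; rewrite leNgt; apply/negP => /reach_lt[r' [_ [r'1|Kr']] r'r].
  by move: r'r; rewrite ltNge (le_trans r1 r'1).
by apply: nKr; exact: Kmono Kr'.
Qed.

End ReachingParameter.

Section ScaleNorm.
Context {R : realType} {G : topGroupType}.
Context (K : R -> set G).
Context (K1 : forall r, 0 < r -> K r 1%g).
Context (KV : forall r g, K r g -> K r (g^-1)%g).
Context (KM : forall r r' g h, K r g -> K r' h -> K (r + r') (g * h)%g).
Context (K_nbhs : forall r, 0 < r -> nbhs 1%g (K r)).

Lemma reach_subadd g h : reach K (g * h)%g <= reach K g + reach K h.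
Proof.
rewrite leNgt; apply/negP; rewrite -ltrBrDr => /(@reach_lt _ _ K)[r [r0 Sr]].
rewrite ltrBrDl -ltrBrDr => /(@reach_lt _ _ K)[r' [r'0 Sr']].
rewrite ltrBrDr; apply/negP; rewrite -leNgt addrC; apply: reach_le.
split; first exact: addr_gt0.
case: Sr => [r1|Kr]; first by left; rewrite (le_trans r1) // lerDl ltW.
case: Sr' => [r'1|Kr']; first by left; rewrite (le_trans r'1) // lerDr ltW.
by right; exact: KM.
Qed.

Lemma reachV g : reach K g = reach K (g^-1)%g.
Proof.
congr inf; apply/seteqP; split=> r [r0 [r1|Kr]]; split => //; try by left.
  by right; exact: KV.
by right; rewrite -(invgK g); exact: KV.
Qed.

Lemma reach_nbhs c : 0 < c -> nbhs 1%g (sball (reach K) c).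
Proof.
move=> c0; have c20 : 0 < c / 2 by rewrite divr_gt0.
apply: filterS (K_nbhs c20) => g Kg; rewrite /sball /=.
apply: (@le_lt_trans _ _ (c / 2)); first by apply: reach_le; split => //; right.
by rewrite ltr_pdivrMr // ltr_pMr // ltr1n.
Qed.

Lemma reach_continuous : continuous (reach K).
Proof.
move=> g; apply/cvgrPdist_lt => e e0.
have ng : nbhs g ((fun h => (g^-1 * h)%g) @^-1` sball (reach K) e).
  by apply: continuous_mulgl; rewrite /= mulVg; exact: reach_nbhs.
apply: filterS ng => h; rewrite /sball /= => gh.
apply: le_lt_trans gh; rewrite ler_norml lerBlDl; apply/andP; split.
  rewrite lerBrDr addrC lerBlDr.
  by have := reach_subadd g (g^-1 * h)%g; rewrite mulgA mulgV mul1g addrC.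
have := reach_subadd h (h^-1 * g)%g; rewrite mulgA mulgV mul1g.
by rewrite (reachV (h^-1 * g)%g) invgM invgK.
Qed.

Lemma reach_SN : SN R G (reach K).
Proof.
split; split.
- exists 1; split; first exact: num_real.
  move=> M M1 g _ /=; rewrite ger0_norm ?reach_ge0 //.
  exact: le_trans (reach_le1 _ _) (ltW M1).
- exact: reach_continuous.
- exact: reach_ge0.
- by apply: reach_eq0 => r; exact: K1.
- exact: reachV.
- exact: reach_subadd.
Qed.

Lemma sball_reach r : 0 < r -> (forall r' r'', r' < r'' -> K r' `<=` K r'') ->
  sball (reach K) (Num.min r 1) `<=` K r.
Proof.
move=> r0 Kmono g; rewrite /sball /= lt_min => /andP[gr g1].
have [r' [_ [r'1|Kr']] r'r] : exists2 r', reaching K g r' & r' < Num.min r 1.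
- by apply: reach_lt; rewrite lt_min gr.
- by move: r'r; rewrite lt_min => /andP[_]; rewrite ltNge r'1.
by move: r'r; rewrite lt_min => /andP[r'r _]; exact: Kmono Kr'.
Qed.

End ScaleNorm.

Definition left_uniform (G : topGroupType) : Type := G.

Section LeftUniformity.
Context (G : topGroupType).
Local Open Scope relation_scope.

HB.instance Definition _ := Choice.on (left_uniform G).

Definition left_entourage : set_system (left_uniform G * left_uniform G) :=
  [set E | exists2 U : set G, nbhs 1%g U &
     forall g h : G, U (g^-1 * h)%g -> E (g, h)].

Lemma left_entourage_filter : Filter left_entourage.
Proof.
split.
- by exists setT => //; exact: filterT.
- move=> E F [U nU UE] [V nV VF]; exists (U `&` V); first exact: filterI.
  by move=> g h [Ugh Vgh]; split; [exact: UE|exact: VF].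
- by move=> E F EF [U nU UE]; exists U => // g h /UE /EF.
Qed.

Lemma left_entourage_refl E : left_entourage E -> diagonal `<=` E.
Proof.
move=> [U nU UE] [g h] /diagonalP ->; apply: UE; rewrite mulVg.
exact: nbhs_singleton.
Qed.

Lemma left_entourage_inv E : left_entourage E -> left_entourage E^-1.
Proof.
move=> [U nU UE]; exists ((fun g => (g^-1)%g) @^-1` U).
  by apply: invg_continuous; rewrite invg1.
by move=> g h /=; rewrite invgM invgK => /UE.
Qed.

Lemma left_entourage_split E : left_entourage E ->
  exists2 F, left_entourage F & F \; F `<=` E.
Proof.
move=> [U nU UE]; have [V sV VVU] := exists_square_root_nbhd nU.
exists [set gh : G * G | V (gh.1^-1 * gh.2)%g].
  by exists V => //; exact: sym_open_nbhd_nbhs.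
move=> [g k] [h /= Vgh Vhk]; apply: UE.
by have := VVU _ _ Vgh Vhk; rewrite mulgA -(mulgA _ h) mulgV mulg1.
Qed.

HB.instance Definition _ := isUniform.Build (left_uniform G)
  left_entourage_filter left_entourage_refl left_entourage_inv
  left_entourage_split.

End LeftUniformity.

(** The gauge of an entourage of the left uniformity is a pseudometric [d]; the
    semi-norm is the supremum over [h] of [d (h, h g)], truncated at [1] and given
    through the sets of those [g] that move every [h] by less than [r]. *)
Lemma exists_seminorm (R : realType) (G : topGroupType) (U : set G) :
  nbhs 1%g U ->
  exists s c, [/\ SN R G s, 0 < c & sball s c `<=` U].
Proof.
move=> nU.
pose E : set (left_uniform G * left_uniform G) :=
  [set gh | U ((gh.1 : G)^-1 * gh.2)%g].
have entE : entourage E by exists U.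
pose T : pseudoMetricType R := gauge.type entE.
pose K (r : R) : set G := [set g | forall h : G, ball (h : T) r ((h * g)%g : T)].
have K1 r : 0 < r -> K r 1%g by move=> r0 h; rewrite mulg1; exact: ballxx.
have KV r g : K r g -> K r (g^-1)%g.
  move=> Kg h; apply: ball_sym.
  by have := Kg (h * g^-1)%g; rewrite -mulgA mulVg mulg1.
have KM r r' g h : K r g -> K r' h -> K (r + r') (g * h)%g.
  by move=> Kg Kh k; rewrite mulgA; apply: ball_triangle (Kg k) (Kh _).
have K_nbhs r : 0 < r -> nbhs 1%g (K r).
  move=> r0.
  have entB : @entourage T [set gh | ball (gh.1 : T) r (gh.2 : T)].
    by rewrite -entourage_ballE; exists r.
  have := gauge.gauge_ent entE entB.
  move=> [V nV VB]; apply: filterS nV => g Vg h.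
  by apply: VB; rewrite mulgA mulVg mul1g.
have : @entourage T E.
  by exists 0%N => // -[g h] [].
rewrite -entourage_ballE => -[r r0 rE].
exists (reach K), (Num.min r 1); split.
- exact: reach_SN.
- by rewrite lt_min r0 ltr01.
- apply: subset_trans (sball_reach r0 _) _.
    by move=> r' r'' r'r'' g Kg h; apply: le_ball (ltW r'r'') _ (Kg h).
  move=> g Kg; have := rE (1%g, g) (_ : ball _ _ _); rewrite /E /= invg1 mul1g; apply.
  by have := Kg 1%g; rewrite mul1g.
Qed.

Lemma SN_seminorm_base (R : realType) (G : topGroupType) : seminorm_base (SN R G).
Proof.
split=> //.
  by move=> s c sN c0; exact: sym_open_nbhd_nbhs (sball_sym_open_nbhd sN c0).
exact: exists_seminorm.
Qed.

(** * The universal equivariant compactification *)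

Lemma compact_set_type (T : topologicalType) (K : set T) :
  compact K -> compact [set: K].
Proof.
move=> cK F PF _.
have [|x [Kx clx]] := cK (set_val @ F) (fmap_proper_filter _ PF).
  by rewrite /= nbhs_simpl /=; apply: filterE => z; exact: (set_mem (valP z)).
exists (SigSub (mem_set Kx)); split=> // A B FA [_ [[C oC <-] Cx CB]].
have [y [[z Az <-] Cz]] : (set_val @` A) `&` C !=set0.
  apply: clx; last by apply: open_nbhs_nbhs.
  by rewrite /= nbhs_simpl /=; apply: filterS FA => z Az; exists z.
by exists z; split=> //; exact: CB.
Qed.

Lemma hausdorff_set_type (T : topologicalType) (K : set T) :
  hausdorff_space T -> hausdorff_space K.
Proof.
move=> hT p q pq; apply: val_inj; apply: hT => A B nA nB.
have cval : continuous (set_val : K -> T) by exact: initial_continuous.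
by have [z [Az Bz]] := pq _ _ (cval p _ nA) (cval q _ nB); exists (set_val z).
Qed.

Lemma compact_hausdorff_regular (T : topologicalType) :
  hausdorff_space T -> compact [set: T] -> regular_space T.
Proof. by move=> hT cT x; apply: (compact_regular hT cT); exact: filterT. Qed.

Lemma continuous_ptws (T : topologicalType) (I : Type) (Y : topologicalType)
    (h : T -> {ptws I -> Y}) :
  (forall i, continuous (fun t => h t i)) -> continuous h.
Proof.
move=> ch t; apply/cvg_sup => i N [_ [[C oC <-] Ci CN]].
by apply: filterS CN _; apply: (ch i t); exact: open_nbhs_nbhs.
Qed.

(** These are the functions to the unit interval that extend continuously to the
    universal equivariant compactification. *)
Definition guniform (R : realType) (G : topGroupType) (Z : gspaceType G)
    (f : Z -> R) : Prop :=
  [/\ continuous f, forall z, 0 <= f z <= 1 &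
      forall e, 0 < e -> \forall g \near (1%g : G),
        forall z, `|f (gact g z) - f z| <= e].

Section GUniform.
Context {R : realType} {G : topGroupType}.

Lemma guniform_act (Z : gspaceType G) (f : Z -> R) (g : G) :
  guniform f -> guniform (fun z => f (gact g z)).
Proof.
move=> [cf f01 fe]; split => [||e e0]; last 1 first.
- have := nbhs_conjg g (fe e e0); apply: filterS => h /= Hh z.
  have := Hh (gact g z).
  by rewrite -gactM -mulgA mulVg mulg1 gactM.
- by apply: (@continuous_o _ _ _ (gact g) f) => //; exact: gact_cts.
- by move=> z; exact: f01.
Qed.

Lemma guniform_comp (Z Y : gspaceType G) (f : Z -> Y) (k : Y -> R) :
  gmap f -> guniform k -> guniform (k \o f).
Proof.
move=> [cf gf] [ck k01 ke]; split => [||e e0].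
- exact: continuous_o.
- by move=> z; exact: k01.
- by apply: filterS (ke e e0) => g /= Hg z; rewrite gf; exact: Hg.
Qed.

(** The displacement [k (g y) - k y] is continuous in [(y, g)] and vanishes at
    [g = 1], so compactness of [Y] makes it uniformly small near [g = 1]. *)
Lemma compact_guniform (Y : gspaceType G) (k : Y -> R) :
  compact [set: Y] -> continuous k -> (forall y, 0 <= k y <= 1) -> guniform k.
Proof.
move=> /compact_near_coveringP cY ck k01; split=> // e e0.
have := cY G (nbhs 1%g) (fun g y => `|k (gact g y) - k y| <= e) _.
have FG : Filter (nbhs (1%g : G)) by exact: nbhs_filter.
move=> /(_ FG) cover; have : forall y, [set: Y] y ->
    \forall y' \near y & g \near (1%g : G), `|k (gact g y') - k y'| <= e.
  move=> y _.
  have cact : continuous (fun p : Y * G => k (gact p.2 p.1)).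
    apply: (@continuous_o _ _ _ (fun p : Y * G => gact p.2 p.1) k) => //.
    apply: (@continuous_o _ (G * Y)%type _ (fun p : Y * G => (p.2, p.1))
      (fun p => gact p.1 p.2)); last exact: gact_continuous.
    by apply: continuous_pair; [exact: continuous_snd|exact: continuous_fst].
  have cdiff : continuous (fun p : Y * G => `|k (gact p.2 p.1) - k p.1|).
    move=> p; apply: cvg_norm; apply: cvgB; first exact: cact.
    exact: (continuous_o (@continuous_fst Y G) ck).
  have oe : open [set r : R | r < e] by exact: open_lt.
  have ne : nbhs `|k (gact 1%g y) - k y| [set r | r < e].
    by apply: open_nbhs_nbhs; split => //=; rewrite gact1 subrr normr0.
  have nP := cdiff (y, 1%g) _ ne.
  by apply: (@filterS _ _ (nbhs_filter (y, 1%g : G)) _ _ _ nP) => p /= /ltW.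
by move=> /cover; apply: filterS => g Hg y; exact: Hg.
Qed.

Lemma flow_separate (Y : gspaceType G) (O : set Y) (y : Y) : flow Y ->
  open O -> O y -> exists k : Y -> R, [/\ continuous k,
    forall t, 0 <= k t <= 1, k y = 0 & forall t, ~ O t -> k t = 1].
Proof.
move=> [[hY _] cY] oO Oy.
have acc : accessible_space Y by apply: hausdorff_accessible.
have us : uniform_separator [set y] (~` O).
  have clO : closed (~` O) by exact: open_closedC.
  have nOy : ~ (~` O) y by apply.
  exact: (normal_completely_regular (compact_normal hY cY) acc clO nOy).
have [k [ck k01 k0 k1]] := (@uniform_separatorP Y R _ _).1 us.
exists k; split=> // [t||t nOt].
- by have /k01 : range k (k t) by [exists t]; rewrite /= in_itv.
- by apply: k0; exists y.
- by apply: k1; exists t.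
Qed.

End GUniform.

Section Compactification.
Context (R : realType) (G : topGroupType) (Z : gspaceType G).

(** The index set of a product, whence the decidable equality. *)
Definition gufun : Type := {classic {f : Z -> R | guniform f}}.

Definition gufun_act (g : G) (f : gufun) : gufun :=
  exist _ (fun z => sval f (gact g z)) (guniform_act g (svalP f)).

Lemma gufun_eq (f f' : gufun) : sval f = sval f' -> f = f'.
Proof. by case: f f' => [f Pf] [f' Pf'] /= ff'; exact: eq_exist. Qed.

Definition evaluation (z : Z) : {ptws gufun -> R} := fun f => sval f z.

Definition compactification : Type := set_type (closure (range evaluation)).

HB.instance Definition _ := Topological.on compactification.

Definition coordinate (f : gufun) (p : compactification) : R := set_val p f.

Lemma proj_ptws_continuous (f : gufun) :
  continuous (fun p : {ptws gufun -> R} => p f).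
Proof. exact: proj_continuous. Qed.

Lemma coordinate_continuous f : continuous (coordinate f).
Proof.
have cval : continuous (set_val : compactification -> {ptws gufun -> R}).
  exact: initial_continuous.
exact: (continuous_o cval (@proj_ptws_continuous f)).
Qed.

Lemma open_coordinate_lt f c : open [set p | coordinate f p < c].
Proof.
exact: (open_preimage (@coordinate_continuous f) (@open_lt R c)).
Qed.

Lemma coordinate_inj (p q : compactification) :
  (forall f, coordinate f p = coordinate f q) -> p = q.
Proof. by move=> pq; apply: val_inj; apply/funext. Qed.

Lemma continuous_coordinates (T : topologicalType) (h : T -> compactification) :
  (forall f, continuous (fun t => coordinate f (h t))) -> continuous h.
Proof.
move=> ch; apply: (@continuous_comp_initial _ _ _ set_val h).
exact: (@continuous_ptws T gufun R (set_val \o h)).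
Qed.

Lemma evaluation_closure z : evaluation z \in closure (range evaluation).
Proof. by apply/mem_set; apply: subset_closure; exists z. Qed.

Definition compactification_emb (z : Z) : compactification :=
  SigSub (evaluation_closure z).

Lemma coordinate_emb f z : coordinate f (compactification_emb z) = sval f z.
Proof. by []. Qed.

Lemma compactification_emb_continuous : continuous compactification_emb.
Proof.
by apply: continuous_coordinates => f; have [] := svalP f.
Qed.

Lemma dense_compactification_emb : dense (range compactification_emb).
Proof.
move=> O [p Op] [C oC CO]; subst O.
have [_ [[z _ <-] Cz]] := closure_open_meet (set_mem (valP p)) oC Op.
by exists (compactification_emb z); split=> //; exists z.
Qed.

(** By density an equality between coordinates, or a closed condition on them,
    is inherited from [Z]. *)
Lemma compactification_closed (C : set compactification) : closed C ->
  (forall z, C (compactification_emb z)) -> C = setT.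
Proof.
move=> clC CZ; apply/seteqP; split=> // p _; apply: contrapT => nCp.
have [|q [nCq [z _ zq]]] := dense_compactification_emb _ (closed_openC clC).
  by exists p.
by apply: nCq; rewrite -zq.
Qed.

Lemma coordinate_diff_le (f f' : gufun) e :
  (forall z, `|sval f z - sval f' z| <= e) ->
  forall p, `|coordinate f p - coordinate f' p| <= e.
Proof.
move=> ffe p.
pose C := [set q | `|coordinate f q - coordinate f' q| <= e].
suff CT : C = setT by have : C p by rewrite CT.
apply: compactification_closed => //.
have cd : continuous (fun q => `|coordinate f q - coordinate f' q|).
  move=> q; have Fq : ProperFilter (nbhs q) by exact: nbhs_pfilter.
  by apply: cvg_norm; apply: cvgB; exact: coordinate_continuous.
exact: (closed_preimage cd (@closed_le R e)).
Qed.

Lemma compactification_act_subproof (g : G) (p : compactification) :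
  ((fun f => set_val p (gufun_act g f)) : {ptws gufun -> R})
    \in closure (range evaluation).
Proof.
apply/mem_set.
pose sh (q : {ptws gufun -> R}) : {ptws gufun -> R} := fun f => q (gufun_act g f).
have csh : continuous sh.
  by apply: continuous_ptws => f; exact: proj_ptws_continuous.
move=> N /(csh (set_val p)) nN.
have [_ [[z _ <-] Nz]] := set_mem (valP p) _ nN.
by exists (evaluation (gact g z)); split => //; exists (gact g z).
Qed.

Definition compactification_act (g : G) (p : compactification) :
    compactification :=
  SigSub (compactification_act_subproof g p).

Lemma coordinate_act f g p :
  coordinate f (compactification_act g p) = coordinate (gufun_act g f) p.
Proof. by []. Qed.

Lemma compactification_act1 p : compactification_act 1%g p = p.
Proof.
apply: coordinate_inj => f; rewrite coordinate_act; congr (coordinate _ p).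
by apply: gufun_eq; apply/funext => z /=; rewrite gact1.
Qed.

Lemma compactification_actM g h p :
  compactification_act (g * h)%g p =
  compactification_act g (compactification_act h p).
Proof.
apply: coordinate_inj => f; rewrite !coordinate_act; congr (coordinate _ p).
by apply: gufun_eq; apply/funext => z /=; rewrite gactM.
Qed.

(** The displacement of a coordinate by [g] near [g0] is small uniformly on
    [Z], hence on the compactification. *)
Lemma compactification_act_continuous :
  continuous (fun gp : G * compactification => compactification_act gp.1 gp.2).
Proof.
apply: continuous_coordinates => f [g0 p0]; apply/cvgrPdist_le => e e0 /=.
have e20 : 0 < e / 2 by rewrite divr_gt0.
have [_ _ /(_ _ e20) nU] := svalP f.
pose U0 : set G :=
  [set g | forall z, `|sval f (gact (g * g0^-1)%g z) - sval f z| <= e / 2].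
have nU0 : nbhs g0 U0.
  rewrite -(mulgV g0) in nU.
  exact: (@continuous_mulgr G (g0^-1)%g g0 _ nU).
have /cvgrPdist_le/(_ _ e20) nP := @coordinate_continuous (gufun_act g0 f) p0.
pose f0 := gufun_act g0 f.
exists (U0, [set p | `|coordinate f0 p0 - coordinate f0 p| <= e / 2]).
  by split.
move=> [g p] /= [Hg Hp]; rewrite !coordinate_act.
rewrite (splitr e) -(subrKA (coordinate (gufun_act g0 f) p)).
apply: le_trans (ler_normD _ _) (lerD Hp _); rewrite distrC.
apply: coordinate_diff_le => z /=.
by have := Hg (gact g0 z); rewrite -gactM -mulgA mulVg mulg1.
Qed.

HB.instance Definition _ := isGSpace.Build G compactification
  compactification_act1 compactification_actM compactification_act_continuous.

Lemma gmap_compactification_emb : gmap compactification_emb.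
Proof.
by split; [exact: compactification_emb_continuous|move=> g z; apply: coordinate_inj].
Qed.

Lemma flow_compactification : flow compactification.
Proof.
have hP : hausdorff_space {ptws gufun -> R}.
  exact: (@hausdorff_product gufun (fun=> R) (fun=> @Rhausdorff R)).
have hS : hausdorff_space compactification by exact: hausdorff_set_type.
suff cS : compact [set: compactification].
  by do 2!split => //; exact: compact_hausdorff_regular.
apply: compact_set_type.
have cube : compact
    [set p : {ptws gufun -> R} | forall f, `[0, 1]%classic (p f)].
  exact: (@tychonoff gufun (fun=> R) (fun=> `[0, 1]%classic)
    (fun=> @segment_compact R 0 1)).
apply: (subclosed_compact _ cube); first exact: closed_closure.
rewrite [X in _ `<=` X](closure_id _).1; last exact: (compact_closed hP cube).
apply: closureS => _ [z _ <-] f.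
by have [_ /(_ z)] := svalP f; rewrite /= in_itv.
Qed.

Section Extension.
Context (Y : gspaceType G) (f : Z -> Y) (flowY : flow Y) (gmapf : gmap f).

Definition gufun_pull (k : Y -> R) (ck : continuous k)
    (k01 : forall y, 0 <= k y <= 1) : gufun :=
  exist _ (k \o f) (guniform_comp gmapf (compact_guniform (proj2 flowY) ck k01)).

(** The value of the extension at [p]: a cluster point of [f] along the trace
    on [Z] of the neighborhoods of [p]. *)
Lemma extension_point (p : compactification) : exists y : Y,
  forall (phi : gufun) (k : Y -> R), continuous k -> sval phi = k \o f ->
    coordinate phi p = k y.
Proof.
pose F : set_system Y := filter_from (nbhs p)
  (fun N => f @` (compactification_emb @^-1` N)).
have PF : ProperFilter F.
  apply: filter_from_proper; last first.
    move=> N; rewrite nbhsE => -[W [oW Wp] WN].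
    have [|q [Wq [z _ zE]]] := dense_compactification_emb _ oW; first by exists p.
    by exists (f z); exists z => //=; apply: WN; rewrite zE.
  apply: filter_from_filter; first by exists setT; exact: filterT.
  move=> A B nA nB; exists (A `&` B); first exact: filterI.
  by move=> _ [z [Az Bz] <-]; split; exists z.
have [y [_ cly]] := proj2 flowY F PF filterT.
exists y => phi k ck phik; apply/eqP; rewrite eq_sym -subr_eq0 -normr_le0.
apply/ler_addgt0Pr => e e0; rewrite add0r.
have cd : continuous (fun t => `|k t - coordinate phi p|).
  by move=> t; apply: cvg_norm; apply: cvgB; [exact: ck|exact: cvg_cst].
have cl : closed [set t | `|k t - coordinate phi p| <= e].
  exact: (closed_preimage cd (@closed_le R e)).
apply: cl; move: cly; rewrite clusterE; apply.
have /cvgrPdist_le/(_ _ e0) nP := @coordinate_continuous phi p.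
exists [set q | `|coordinate phi p - coordinate phi q| <= e] => //.
by move=> _ [z /= + <-]; rewrite coordinate_emb distrC phik.
Qed.

Lemma flow_eq (y y' : Y) : (forall k : Y -> R, continuous k ->
  (forall t, 0 <= k t <= 1) -> k y = k y') -> y = y'.
Proof.
move=> yy'; apply: contrapT => ne.
have hY : hausdorff_space Y by case: flowY => -[].
have oC : open (~` [set y']).
  by apply: closed_openC; exact: closed_set1_hausdorff.
have [k [ck k01 ky kn]] := flow_separate (R := R) flowY oC ne.
have := yy' k ck k01; rewrite ky kn => [/eqP|]; last by apply.
by rewrite eq_sym oner_eq0.
Qed.

Lemma compactification_extension :
  exists2 h : compactification -> Y, gmap h & h \o compactification_emb = f.
Proof.
have [h hE] := choice extension_point.
have hP (k : Y -> R) (ck : continuous k) (k01 : forall t, 0 <= k t <= 1) p :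
    coordinate (gufun_pull ck k01) p = k (h p) by exact: hE.
exists h; last first.
  apply/funext => z; apply: flow_eq => k ck k01 /=.
  by rewrite -(hP k ck k01) coordinate_emb.
split=> [p N|g p].
  rewrite nbhsE => -[W [oW Wp] WN].
  have [k [ck k01 k0 k1]] := flow_separate (R := R) flowY oW Wp.
  have oS : open [set q | coordinate (gufun_pull ck k01) q < 1].
    exact: open_coordinate_lt.
  have nS : nbhs p [set q | coordinate (gufun_pull ck k01) q < 1].
    by apply: open_nbhs_nbhs; split=> //=; rewrite hP k0 ltr01.
  apply: filterS nS => q /=; rewrite hP => kq; apply: WN; apply: contrapT => /k1.
  by move=> k1q; rewrite k1q ltxx in kq.
apply: flow_eq => k ck k01; rewrite -(hP k ck k01) coordinate_act.
apply: (hE p _ (fun y => k (gact g y))).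
  by apply: (@continuous_o _ _ _ (gact g) k) => //; exact: gact_cts.
by apply/funext => z /=; rewrite (proj2 gmapf).
Qed.

End Extension.

Lemma universal_compactification_separated : hausdorff_space Z ->
  (forall (O : set Z) z, open O -> O z ->
     exists f : gufun, sval f z = 0 /\ forall t, ~ O t -> sval f t = 1) ->
  universal_compactification compactification_emb.
Proof.
move=> hZ sepZ; split.
- exact: flow_compactification.
- exact: gmap_compactification_emb.
- split.
    move=> z z' zz'; apply: contrapT => ne.
    have oC : open (~` [set z']).
      by apply: closed_openC; exact: closed_set1_hausdorff.
    have [f [f0 f1]] := sepZ _ _ oC ne.
    have := congr1 (coordinate f) zz'; rewrite !coordinate_emb f0 f1 => [/eqP|]; last by apply.
    by rewrite eq_sym oner_eq0.
  apply/seteqP; split=> [W oW|_ [B oB <-]]; last first.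
    by apply: open_comp => // z _; exact: compactification_emb_continuous.
  pose D := [set f : gufun | forall t, ~ W t -> sval f t = 1].
  exists (\bigcup_(f in D) [set q | coordinate f q < 1]).
    by apply: bigcup_open => f _; exact: open_coordinate_lt.
  apply/seteqP; split=> z /=.
    move=> [f Df /=]; rewrite coordinate_emb => fz1; apply: contrapT => /Df fz.
    by rewrite fz ltxx in fz1.
  by move=> Wz; have [f [f0 f1]] := sepZ W z oW Wz; exists f => //=;
    rewrite coordinate_emb f0 ltr01.
- exact: dense_compactification_emb.
- by move=> Y f flowY gmapf; exact: compactification_extension.
Qed.

End Compactification.

(** * Copies of a flow and their compactification *)

Section Copies.
Context {G : topGroupType} {I : choiceType} {X : gspaceType G}.

Lemma copies_continuous (T : topologicalType) (h : I -> X -> T) :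
  (forall i, continuous (h i)) -> continuous (fun p : copies I X => h p.1 p.2).
Proof.
move=> ch [j y] N nN; exists ([set j], h j @^-1` N).
  split; last exact: (ch j y).
  by rewrite /= nbhs_principalE.
by move=> [j' y'] /= [->].
Qed.

Lemma copies_slice_continuous (i : I) :
  continuous (fun y : X => (i, y) : copies I X).
Proof.
apply: (@continuous_pair X (discrete_topology I) X (fun=> i) id).
  exact: continuous_const.
exact: continuous_idfun.
Qed.

Lemma open_copies_slice (i : I) (W : set (copies I X)) : open W ->
  open [set y | W (i, y)].
Proof.
exact: (open_preimage (@copies_slice_continuous i)).
Qed.

Lemma copies_hausdorff : hausdorff_space X -> hausdorff_space (copies I X).
Proof.
move=> hX [i x] [j y] pq.
have cfst : continuous (fun p : copies I X => p.1 : discrete_topology I).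
  by apply: (@copies_continuous (discrete_topology I) (fun i _ => i)) => k;
    exact: continuous_const.
have csnd : continuous (fun p : copies I X => p.2).
  by apply: (@copies_continuous X (fun _ y => y)) => k; exact: continuous_idfun.
have ij : i = j.
  have n1 (k : I) : nbhs (k : discrete_topology I) [set k] by rewrite nbhs_principalE.
  by have [[k z] /= [-> ->]] := pq _ _ (cfst (i, x) _ (n1 i)) (cfst (j, y) _ (n1 j)).
congr pair => //; apply: hX => A B nA nB.
have [[k z] /= [Az Bz]] := pq _ _ (csnd (i, x) _ nA) (csnd (j, y) _ nB).
by exists z.
Qed.

Lemma guniform_copies (R : realType) (h : I -> X -> R) :
  (forall i, continuous (h i)) -> (forall i y, 0 <= h i y <= 1) ->
  (forall e, 0 < e -> \forall g \near (1%g : G),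
     forall i y, `|h i (gact g y) - h i y| <= e) ->
  guniform (fun p : copies I X => h p.1 p.2).
Proof.
move=> ch h01 he; split=> [||e e0]; first exact: copies_continuous.
- by move=> p; exact: h01.
- by apply: filterS (he e e0) => g Hg [i y]; exact: Hg.
Qed.

End Copies.

(** With the trivial action, the universal property for flows also gives the
    projection to [beta I]. *)
Definition trivial_gspace (G : topGroupType) (T : Type) : Type := T.

Section TrivialAction.
Context (G : topGroupType) (T : topologicalType).

HB.instance Definition _ := Topological.copy (trivial_gspace G T) T.

Lemma trivial_act_continuous :
  continuous (fun gt : G * trivial_gspace G T => gt.2).
Proof. exact: continuous_snd. Qed.

HB.instance Definition _ := isGSpace.Build G (trivial_gspace G T)
  (gact := fun _ t => t) (fun=> erefl) (fun _ _ _ => erefl)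
  trivial_act_continuous.

End TrivialAction.

(** An ultrafilter [F] on [beta I] converges to the ultrafilter of those [J] for
    which the basic open set of [J] belongs to [F]. *)
Lemma beta_compact (I : Type) : compact [set: beta I].
Proof.
rewrite compact_ultra => F UF _.
pose u : set_system I := [set J | F (beta_basic J)].
have FF : ProperFilter F by exact: ultra_proper.
have Fu : Filter u.
  split.
  - rewrite /u /= (_ : beta_basic setT = setT); first exact: filterT.
    apply/seteqP; split=> // v _; have := beta_ultra v => Uv; exact: filterT.
  - move=> J K FJ FK; apply: (@filterS _ F _ _ _ _ (@filterI _ F _ _ _ FJ FK)) => v [vJ vK].
    by have := beta_ultra v => Uv; exact: filterI.
  - move=> J K JK; apply: (@filterS _ F) => v vJ.
    by have := beta_ultra v => Uv; exact: filterS vJ.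
have Pu : ProperFilter u.
  apply: (Build_ProperFilter_ex _ Fu) => J /(@filter_ex _ F _)[v vJ].
  by have := beta_ultra v => Uv; exact: filter_ex vJ.
have Uu : UltraFilter u.
  split=> // H PH uH; apply/seteqP; split=> // J HJ.
  have [//|FJ] := in_ultra_setVsetC (beta_basic J) UF.
  have uJ : u (~` J).
    apply: (@filterS _ F _ _ _ _ FJ) => v nvJ; have := beta_ultra v => Uv.
    by have [//|] := in_ultra_setVsetC J Uv.
  have : H set0 by rewrite -(setICr J); apply: filterI => //; exact: uH.
  by move/filter_not_empty.
exists (Beta Uu); split=> // N; rewrite nbhsE => -[W [[D _ WD] Wu] WN].
move: Wu; rewrite -WD => -[J DJ uJ].
apply: (@filterS _ F _ _ _ _ uJ) => v vJ.
by apply: WN; rewrite -WD; exists J.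
Qed.

Lemma flow_beta (G : topGroupType) (I : Type) : flow (trivial_gspace G (beta I)).
Proof.
split; last exact: beta_compact.
split; first exact: beta_hausdorff.
exact: compact_hausdorff_regular (@beta_hausdorff I) (@beta_compact I).
Qed.

Section SGCopies.
Context (R : realType) (G : topGroupType) (I : choiceType) (X : gspaceType G).
Context (flowX : flow X).

Lemma universal_compactification_copies :
  universal_compactification (@compactification_emb R G (copies I X)).
Proof.
have [[hX _] cX] := flowX.
apply: universal_compactification_separated; first exact: copies_hausdorff.
move=> W [i y] oW Wiy.
have [k [ck k01 k0 k1]] := flow_separate (R := R) flowX (open_copies_slice i oW) Wiy.
have [_ _ ke] := compact_guniform cX ck k01.
pose h (j : I) (t : X) : R := if j == i then k t else 1.
have uh : guniform (fun p : copies I X => h p.1 p.2).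
  apply: guniform_copies => [j|j t|e e0]; rewrite /h.
  - by case: (j == i) => //; exact: continuous_const.
  - by case: (j == i) => //; rewrite ler01 lexx.
  - apply: filterS (ke e e0) => g Hg j t; case: (j == i); first exact: Hg.
    by rewrite subrr normr0 ltW.
exists (exist _ _ uh); split; first by rewrite /= /h eqxx.
move=> [j t] /= nW; rewrite /h; case: eqP => // ji; apply: k1.
by rewrite -ji.
Qed.

Lemma exists_projI : exists2 h : compactification R (copies I X) ->
  trivial_gspace G (beta I), gmap h &
  h \o @compactification_emb R G (copies I X) = (fun p => beta_unit p.1).
Proof.
have [_ _ _ _] := universal_compactification_copies; apply; first exact: flow_beta.
split=> //.
apply: (@copies_continuous G I X (beta I) (fun i _ => beta_unit i)) => i.
exact: continuous_const.
Qed.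

Lemma exists_projX : exists2 h : compactification R (copies I X) -> X, gmap h &
  h \o @compactification_emb R G (copies I X) = snd.
Proof.
have [_ _ _ _] := universal_compactification_copies; apply => //; split=> //.
apply: (@copies_continuous G I X X (fun _ y => y)) => i.
exact: continuous_idfun.
Qed.

(** The extensions [phi] do not follow from the universal property, as [R] is not
    a flow. *)
Lemma exists_SG_copies : exists S : SG_copies I X,
  forall f : gufun R (copies I X), exists2 phi : S -> R,
    continuous phi & forall p, phi (SG_emb S p) = sval f p.
Proof.
have [hI [cI _] hIE] := exists_projI; have [hX [cX _] hXE] := exists_projX.
have EI p : hI (compactification_emb R p) = beta_unit p.1.
  by rewrite -[LHS]/((hI \o _) p) hIE.
have EX p : hX (compactification_emb R p) = p.2.
  by rewrite -[LHS]/((hX \o _) p) hXE.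
exists (Build_SG_copies universal_compactification_copies cI EI cX EX) => f.
by exists (coordinate f) => //; exact: coordinate_continuous.
Qed.

End SGCopies.

(** * Ultracopowers *)

Lemma continuous_dense_eq (S T : topologicalType) (f g : S -> T) (D : set S) :
  hausdorff_space T -> continuous f -> continuous g -> dense D ->
  (forall d, D d -> f d = g d) -> f = g.
Proof.
move=> hT cf cg dD fg; apply/funext => s; apply: hT => A B nA nB.
have : nbhs s (f @^-1` A `&` g @^-1` B) by apply: filterI; [exact: cf|exact: cg].
rewrite nbhsE => -[W [oW Ws] WAB].
have [d [Wd Dd]] := dD W (ex_intro _ s Ws) oW.
by have [Ad Bd] := WAB d Wd; exists (f d); split=> //; rewrite fg.
Qed.

Section UltracopowerFacts.
Context {G : topGroupType} {I : choiceType} {X : gspaceType G}.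
Context (S : SG_copies I X) (u : beta I).

Lemma SG_projX_act : hausdorff_space X -> forall g (z : S),
  SG_projX (gact g z) = gact g (SG_projX z).
Proof.
move=> hX g; have [_ [_ actE] _ dS _] := SG_universal S.
have cX := @SG_projX_continuous _ _ _ S.
suff : (fun z : S => SG_projX (gact g z)) = (fun z => gact g (SG_projX z)).
  by move=> E z; exact: (congr1 (fun f => f z) E).
apply: (continuous_dense_eq hX _ _ dS).
- exact: (continuous_o (@gact_cts G S g) cX).
- exact: (continuous_o cX (@gact_cts G X g)).
- by move=> _ [p _ <-]; rewrite -actE !SG_projXE.
Qed.

(** A cluster point of [h] along [u], which satisfies every closed condition
    that holds [u]-often. *)
Lemma ultralimit (h : I -> S) : (forall i, SG_projI (h i) = beta_unit i) ->
  exists2 z : S, SG_projI z = u &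
    forall C : set S, closed C -> beta_sets u [set i | C (h i)] -> C z.
Proof.
move=> hI; have [[_ cS] _ _ _ _] := SG_universal S.
have Uu := beta_ultra u.
have Pu : ProperFilter (beta_sets u) by exact: ultra_proper.
have [z [_ clz]] := cS (h @ beta_sets u) (fmap_proper_filter h Pu) filterT.
have zC (C : set S) : closed C -> beta_sets u [set i | C (h i)] -> C z.
  move=> clC uC; apply: clC; move: clz; rewrite clusterE; exact.
exists z => //; apply/esym/beta_eq => J uJ.
have cI := @SG_projI_continuous _ _ _ S.
have clJ : closed [set v : beta I | beta_sets v J].
  have -> : [set v : beta I | beta_sets v J] = ~` (beta_basic (~` J)).
    apply/seteqP; split=> v; have := beta_ultra v => Uv vJ.
      move=> vNJ; have : beta_sets v set0 by rewrite -(setICr J); exact: filterI.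
      exact: filter_not_empty.
    by have [//|/vJ] := in_ultra_setVsetC J Uv.
  by apply: open_closedC; exact: open_beta_basic.
apply: (zC (SG_projI (s := S) @^-1` [set v : beta I | beta_sets v J])).
  exact: (closed_preimage cI clJ).
by apply: filterS uJ => i Ji; rewrite /= hI; exact/principal_filterP.
Qed.

Lemma gmap_ultracopower_map : hausdorff_space X ->
  gmap (@ultracopower_map G I X S u).
Proof.
move=> hX; split; last by move=> g z; exact: SG_projX_act.
have cval : continuous (set_val : ultracopower S u -> S).
  exact: initial_continuous.
exact: (continuous_o cval (@SG_projX_continuous _ _ _ S)).
Qed.

Lemma ultracopower_map_surj : hausdorff_space X -> forall x : X,
  exists z, @ultracopower_map G I X S u z = x.
Proof.
move=> hX x.
have [z zI zC] := ultralimit (fun i => SG_projIE S (i, x)).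
exists (SigSub (mem_set (zI : ultracopower_set u z))).
apply: (zC (SG_projX (s := S) @^-1` [set x])).
  exact: (closed_preimage (@SG_projX_continuous _ _ _ S)
    (@closed_set1_hausdorff X x hX)).
have Uu := beta_ultra u.
by apply: filterS filterT => i _; rewrite /= SG_projXE.
Qed.

End UltracopowerFacts.

(** The inverse is continuous as [f] maps closed sets to compact, hence closed,
    sets. *)
Lemma compact_bijective_gisomorphism (G : topGroupType) (Y Z : gspaceType G)
    (f : Y -> Z) : compact [set: Y] -> hausdorff_space Z -> gmap f ->
  injective f -> (forall z, exists y, f y = z) -> gisomorphism f.
Proof.
move=> cY hZ [cf gf] injf surjf; split=> //.
have [h fh] := choice surjf.
have hf : cancel f h by move=> y; apply: injf; rewrite fh.
exists h; split=> //; split; last by move=> g z; apply: injf; rewrite gf !fh.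
apply/continuous_closedP => C clC.
have -> : h @^-1` C = f @` C.
  apply/seteqP; split=> [z Cz|_ [y Cy <-]]; last by rewrite /= hf.
  by exists (h z).
apply: (compact_closed hZ); apply: continuous_compact.
  by apply: continuous_subspaceT.
exact: (subclosed_compact clC cY).
Qed.

(** Continuity of the action at [(1, z)] and [(1, z')] shrinks disjoint
    neighborhoods of the two points to ones with disjoint translates. *)
Lemma separate_translates (G : topGroupType) (S : gspaceType G) (z z' : S) :
  hausdorff_space S -> z <> z' ->
  exists U A A', [/\ nbhs (1%g : G) U, open_nbhs z A, open_nbhs z' A' &
    smul U A `&` smul U A' = set0].
Proof.
rewrite open_hausdorff => hS /eqP /hS[[B B'] /=].
rewrite !inE => -[Bz Bz'] [oB oB' BB'].
have ex (t : S) (W : set S) : open W -> W t ->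
    exists U A, [/\ nbhs (1%g : G) U, open_nbhs t A & smul U A `<=` W].
  move=> oW Wt.
  have nW : nbhs (gact 1%g t) W by rewrite gact1; exact: open_nbhs_nbhs.
  have [[U A] /= [nU]] := @gact_continuous G S (1%g, t) _ nW.
  rewrite nbhsE => -[A0 oA0 A0A] UAW; exists U, A0; split=> //.
  by move=> _ [g Ug [a /A0A Aa <-]]; exact: (UAW (g, a)).
have [U [A [nU oA UA]]] := ex z B oB Bz.
have [U' [A' [nU' oA' UA']]] := ex z' B' oB' Bz'.
exists (U `&` U'), A, A'; split=> //; first exact: filterI.
apply/seteqP; split=> // t [tA tA']; rewrite -BB'; split.
  by apply: UA; apply: smulS tA => // ? [].
by apply: UA'; apply: smulS tA' => // ? [].
Qed.

Section RsetUltracopower.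
Context {G : topGroupType} {I : choiceType} {X : gspaceType G}.
Context (S : SG_copies I X) (u : beta I).

(** Otherwise the complement of this set of indices would be [u]-large, and cut
    out of [A] a neighborhood of [z] that misses the dense copies of [X]. *)
Lemma ultracopower_trace (z : S) (A : set S) (B : set X) :
  SG_projI z = u -> open_nbhs z A -> open_nbhs (SG_projX z) B ->
  beta_sets u [set i | exists2 y, A (SG_emb S (i, y)) & B y].
Proof.
move=> zu [oA Az] [oB Bz]; set J := [set i | _].
have Uu := beta_ultra u.
have [//|uNJ] := in_ultra_setVsetC J Uu.
have [_ _ _ dS _] := SG_universal S.
have oI : open (SG_projI (s := S) @^-1` beta_basic (~` J)).
  exact: (open_preimage (@SG_projI_continuous _ _ _ S)
    (open_beta_basic (~` J))).
have oX : open (SG_projX (s := S) @^-1` B).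
  exact: (open_preimage (@SG_projX_continuous _ _ _ S) oB).
have [|p [[Ap [NJp Bp]] [[i y] _ pE]]] := dS _ _ (openI oA (openI oI oX)).
  by exists z; do 2!split => //; rewrite /= zu.
exfalso; move: NJp Ap Bp; rewrite -pE /= SG_projIE SG_projXE => NJi Aiy By.
by have /principal_filterP := NJi; apply; exists y.
Qed.

(** Distinct points of the ultracopower over [x] would have traces on some copy
    of [X] which both meet [R_V[x]] and have disjoint translates. *)
Lemma Rset_nbhd_ultracopower_inj : hausdorff_space X -> G_ED X ->
  @Rset_nbhd G X -> injective (@ultracopower_map G I X S u).
Proof.
move=> hX edX RX z z' zz'; apply: contrapT => ne.
have [[[hS _] cS] [cemb gemb] _ _ _] := SG_universal S.
have nev : set_val z <> set_val z' by move=> /val_inj.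
have [U [A [A' [nU [oA Az] [oA' A'z'] dis]]]] := separate_translates hS nev.
have [V sV VVU] := exists_square_root_nbhd nU.
pose x := ultracopower_map z.
have nB : open_nbhs x (Rset V x)°.
  by split; [exact: open_interior|exact: RX].
have uJ := ultracopower_trace (set_mem (valP z)) (conj oA Az) nB.
have := nB; rewrite {1}/x zz' => nB'.
have uJ' := ultracopower_trace (set_mem (valP z')) (conj oA' A'z') nB'.
have Uu := beta_ultra u.
have /filter_ex[i [[y Ay /interior_subset Ry] [y' Ay' /interior_subset Ry']]] :
  beta_sets u ([set i | exists2 y, A (SG_emb S (i, y)) & (Rset V x)° y] `&`
               [set i | exists2 y, A' (SG_emb S (i, y)) & (Rset V x)° y]).
  exact: filterI.
have oslice (C : set S) : open C -> open [set y | C (SG_emb S (i, y))].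
  move=> oC; apply: (open_copies_slice i (W := SG_emb S @^-1` C)).
  exact: (open_preimage cemb oC).
have [w [wA wA']] := G_ED_Rset_meet edX sV VVU (oslice _ oA) (oslice _ oA')
  Ay Ry Ay' Ry'.
have push (C : set S) : smul U [set y | C (SG_emb S (i, y))] w ->
    smul U C (SG_emb S (i, w)).
  move=> [g Ug [y0 Cy0 <-]]; exists g => //; exists (SG_emb S (i, y0)) => //.
  by rewrite -gemb.
by rewrite -[False]/(set0 (SG_emb S (i, w))) -dis; split; exact: push.
Qed.

Lemma Rset_nbhd_ultracopower : hausdorff_space X -> G_ED X ->
  @Rset_nbhd G X -> gisomorphism (@ultracopower_map G I X S u).
Proof.
move=> hX edX RX; have [[[hS _] cS] _ _ _ _] := SG_universal S.
apply: compact_bijective_gisomorphism => //.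
- change (compact [set: set_type (ultracopower_set (S := S) u)]).
  apply: compact_set_type.
  have clu : closed [set u] by exact: (@closed_set1_hausdorff _ u (@beta_hausdorff I)).
  have clS := (continuous_closedP _).1 (@SG_projI_continuous _ _ _ S) _ clu.
  exact: (subclosed_compact clS cS).
- exact: gmap_ultracopower_map.
- exact: Rset_nbhd_ultracopower_inj.
- exact: ultracopower_map_surj.
Qed.

End RsetUltracopower.

(** * Distances to open sets in G-ED spaces *)

Section ThickeningDistance.
Context {R : realType} {G : topGroupType} {X : gspaceType G}.
Context (edX : G_ED X) (s : G -> R) (sN : SN R G s) (A : set X) (oA : open A).

Definition closed_thickening (r : R) : set X := closure (smul (sball s r) A).

Lemma closed_thickening_mono r r' : r < r' ->
  closed_thickening r `<=` closed_thickening r'.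
Proof.
by move=> rr'; apply: closureS; apply: smulS => // g /= /lt_trans; exact.
Qed.

Lemma sballM r r' g h : sball s r g -> sball s r' h -> sball s (r + r') (g * h)%g.
Proof.
move=> gr hr'; have [_ [_ _ sM]] := sN.
exact: le_lt_trans (sM g h) (ltrD gr hr').
Qed.

Lemma closed_thickening_interior r r' : r < r' ->
  closed_thickening r `<=` (closed_thickening r')°.
Proof.
move=> rr' x clx; have r'r : 0 < r' - r by rewrite subr_gt0.
apply: interiorS (edX (open_smul _ oA)
  (sym_open_nbhd_nbhs (sball_sym_open_nbhd sN r'r)) clx).
apply: closureS; apply: smul_smul => g h Bg Bh.
by rewrite -(subrK r r'); exact: sballM.
Qed.

Lemma closed_thickening_act r g x : closed_thickening r x ->
  closed_thickening (r + s g) (gact g x).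
Proof.
move=> clx; apply: (closureS (A := smul [set g] (smul (sball s r) A))).
  apply: smul_smul => _ h -> Bh; have [_ [_ _ sM]] := sN.
  by apply: le_lt_trans (sM g h) _; rewrite addrC ltrD2r.
by apply: smul_closure; exists g => //; exists x.
Qed.

Definition thickening_dist : X -> R := reach closed_thickening.

(** The distance is upper semi-continuous because a closed thickening lies in the
    interior of every larger one, and lower semi-continuous because closed
    thickenings are closed. *)
Lemma thickening_dist_near_lt x e : 0 < e ->
  \forall y \near x, thickening_dist y < thickening_dist x + e.
Proof.
move=> e0.
have : thickening_dist x < thickening_dist x + e by rewrite ltrDl.
move=> /(@reach_lt _ _ closed_thickening)[r [r0 [r1|Kr]] rxe].
  apply: filterE => y; apply: le_lt_trans rxe.
  exact: le_trans (reach_le1 _ _) r1.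
pose r' := (r + (thickening_dist x + e)) / 2.
have [rr' r'xe] : r < r' /\ r' < thickening_dist x + e.
  by split; rewrite ?midf_lt.
apply: filterS (closed_thickening_interior rr' Kr) => y Kr'y.
apply: le_lt_trans r'xe; apply: reach_le; split; first exact: lt_trans rr'.
by right.
Qed.

Lemma thickening_dist_near_gt x e : 0 < e ->
  \forall y \near x, thickening_dist x - e < thickening_dist y.
Proof.
move=> e0; pose r := thickening_dist x - e / 2.
have xer : thickening_dist x - e < r.
  by rewrite ltrD2l ltrN2 ltr_pdivrMr // ltr_pMr // ltr1n.
have rx : r < thickening_dist x by rewrite ltrBlDr ltrDl divr_gt0.
have [r0|r0] := leP r 0.
  apply: filterE => y; apply: (lt_le_trans xer).
  exact: le_trans r0 (reach_ge0 _ _).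
have r1 : r <= 1 by exact: le_trans (ltW rx) (reach_le1 _ _).
have nK : ~ closed_thickening r x.
  move=> Kr; have : thickening_dist x <= r by apply: reach_le; split=> //; right.
  by rewrite leNgt rx.
have oK : open (~` closed_thickening r).
  by apply: closed_openC; exact: closed_closure.
apply: filterS (open_nbhs_nbhs (conj oK nK)) => y nKy.
by apply: (lt_le_trans xer); apply: le_reach nKy => //; exact: closed_thickening_mono.
Qed.

Lemma thickening_dist_continuous : continuous thickening_dist.
Proof.
move=> x; apply/cvgrPdist_lt => e e0.
apply: filterS (filterI (thickening_dist_near_lt x e0)
  (thickening_dist_near_gt x e0)) => y /= [yx xy].
by rewrite distrC ltr_distl xy yx.
Qed.

Lemma thickening_dist_act_le g x :
  thickening_dist (gact g x) <= thickening_dist x + s g.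
Proof.
rewrite -lerBlDr leNgt; apply/negP => /(@reach_lt _ _ closed_thickening).
move=> [r [r0 Sr]]; rewrite ltrBrDr ltNge => /negP; apply; apply: reach_le.
have [[_ _ s0] _] := sN; split; first exact: ltr_wpDr.
case: Sr => [r1|Kr]; first by left; rewrite (le_trans r1) // lerDl.
by right; exact: closed_thickening_act.
Qed.

Lemma thickening_dist_act g x :
  `|thickening_dist (gact g x) - thickening_dist x| <= s g.
Proof.
have [_ [_ sV _]] := sN.
rewrite ler_distl thickening_dist_act_le andbT lerBlDr.
by have := thickening_dist_act_le (g^-1)%g (gact g x); rewrite gactK -sV.
Qed.

Lemma thickening_dist_eq0 x : A x -> thickening_dist x = 0.
Proof.
move=> Ax; apply: reach_eq0 => r r0; apply: subset_closure.
apply: subset_smul => //; have [_ [s1 _ _]] := sN.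
by rewrite /sball /= s1.
Qed.

Lemma le_thickening_dist r x : r <= 1 -> ~ closed_thickening r x ->
  r <= thickening_dist x.
Proof. by apply: le_reach; exact: closed_thickening_mono. Qed.

End ThickeningDistance.

(** * Ultracopowers and G-finiteness *)

Section UltracopowerFinite.
Context (R : realType) {G : topGroupType} {X : gspaceType G}.
Context (flowX : flow X) (edX : G_ED X).

(** If the translates [U A_n] are disjoint, take [x_n] in [A_n] and a free
    ultrafilter: the limit of the points [(n, x_n)] and that of the points
    [(n, x)], for [x] the image in [X] of the former, lie over the same point. The
    distances to [A_n] form one function on the copies of [X]; it separates the
    two limits as [x] is far from all but one [A_n]. *)
Lemma ultracopower_inj_G_finite :
  (forall (S : SG_copies nat X) (u : beta nat),
     injective (@ultracopower_map G nat X S u)) -> G_finite X.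
Proof.
move=> injX U sU F oF trivF; apply: contrapT => /infiniteP.
move=> /(@pcard_leP nat (set X))/unsquash A.
have FA n : F (A n) by exact: funS.
have oA n : open (A n) by have [] := oF _ (FA n).
have disA m n : m <> n -> smul U (A m) `&` smul U (A n) = set0.
  move=> mn; apply: contrapT => /eqP/set0P meet; apply: mn.
  apply: (@inj _ _ _ A); rewrite ?in_setT //.
  exact: (trivF _ _ (FA m) (FA n) meet).
have [V sV VVU] := exists_square_root_nbhd (sym_open_nbhd_nbhs sU).
have [s [c [sN c0 scV]]] := exists_seminorm R (sym_open_nbhd_nbhs sV).
pose c1 := Num.min c 1.
have c10 : 0 < c1 by rewrite lt_min c0 ltr01.
have [x_ xA] := choice (fun n => (oF _ (FA n)).2).
have [[hX _] cX] := flowX.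
pose d (n : nat) := thickening_dist s (A n).
have ud : guniform (fun p : copies nat X => d p.1 p.2).
  apply: guniform_copies => [n|n y|e e0].
  - exact: thickening_dist_continuous.
  - by rewrite /d reach_ge0 reach_le1.
  - have := sym_open_nbhd_nbhs (sball_sym_open_nbhd sN e0).
    apply: filterS => g ge n y.
    exact: le_trans (thickening_dist_act sN _ _ _) (ltW ge).
have [S /(_ (exist _ _ ud))[phi cphi phiE]] := exists_SG_copies R nat flowX.
have [u [Uu free]] := ultraFilterLemma eventually_filter.
pose v : beta nat := Beta Uu.
have [z zv zC] := ultralimit v (fun n => SG_projIE S (n, x_ n)).
pose x := SG_projX z.
have [z' z'v z'C] := ultralimit v (fun n => SG_projIE S (n, x)).
have z'x : SG_projX z' = x.
  apply: (z'C (SG_projX (s := S) @^-1` [set x])).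
    exact: (closed_preimage (@SG_projX_continuous _ _ _ S)
    (@closed_set1_hausdorff X x hX)).
  by apply: filterS filterT => n _; rewrite /= SG_projXE.
have phiz : phi z <= 0.
  apply: (zC (phi @^-1` [set r | r <= 0])).
    exact: (closed_preimage cphi (@closed_le R 0)).
  apply: filterS filterT => n _ /=; rewrite phiE /= /d.
  by rewrite (thickening_dist_eq0 sN (xA n)).
have far n m : n <> m -> ~ closed_thickening s (A n) c1 x \/
    ~ closed_thickening s (A m) c1 x.
  move=> nm; apply/not_andP => -[cln clm].
  have toV k : closed_thickening s (A k) c1 x -> closure (smul V (A k)) x.
    apply: closureS; apply: smulS => // g; rewrite /sball /= lt_min => /andP[gc _].
    exact: scV.
  have [w [VVn Vm]] := G_ED_meet edX sV (oA n) (oA m) (toV n cln) (toV m clm).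
  rewrite -[False]/(set0 w) -(disA n m nm); split; first exact: smul_smul VVn.
  apply: smulS Vm => // g Vg; rewrite -(mulg1 g); apply: VVU => //.
  by case: sV.
have phiz' : c1 <= phi z'.
  apply: (z'C (phi @^-1` [set r | c1 <= r])).
    exact: (closed_preimage cphi (@closed_ge R c1)).
  have c11 : c1 <= 1 by rewrite ge_min lexx orbT.
  have [[m clm]|nocl] := pselect (exists m, closed_thickening s (A m) c1 x).
    (* [x] is close to no other [A n], and [v] contains the cofinite sets *)
    apply: free; exists m.+1 => // n /= mn; rewrite phiE /=.
    apply: le_thickening_dist => //.
    have [|//|//] := far n m; by move=> nm; rewrite nm ltnn in mn.
  apply: filterS filterT => n _ /=; rewrite phiE /=.
  by apply: le_thickening_dist => // cln; apply: nocl; exists n.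
pose w : ultracopower S v := SigSub (mem_set (zv : ultracopower_set v z)).
pose w' : ultracopower S v := SigSub (mem_set (z'v : ultracopower_set v z')).
have /(congr1 val) /= zz' : w = w' by apply: (injX S v); rewrite /ultracopower_map /= z'x.
by move: (lt_le_trans c10 phiz'); rewrite -zz' ltNge phiz.
Qed.

End UltracopowerFinite.

(** * The equivalence *)

Theorem theorem5p5 (R : realType) (G : topGroupType) (X : gspaceType G)
    (hausG : hausdorff_regular G) (flowX : flow X) (edX : G_ED X) :
  [<-> G_finite X;
       forall U : set G, sym_open_nbhd U ->
         exists F : set (set X),
           [/\ finite_set F, forall A, F A -> TT U A &
               \bigcup_(A in F) A = [set: X]];
       G_discrete X;
       forall (U : set G) (x : X), sym_open_nbhd U -> (Rset U x)° x;
       forall (I : choiceType) (S : SG_copies I X) (u : beta I),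
         gisomorphism (@ultracopower_map G I X S u);
       forall s : G -> R, SN R G s -> compatible X s;
       exists2 B : set (G -> R), seminorm_base B &
         forall s, B s -> compatible X s].
Proof.
have [[hX _] cX] := flowX.
tfae.
- by move=> finX U sU; exact: G_finite_TT_cover.
- exact: TT_cover_G_discrete.
- exact: G_discrete_Rset_nbhd.
- by move=> RX I S u; exact: Rset_nbhd_ultracopower.
- move=> isoX s sN; apply: Rset_nbhd_compatible => //.
  apply: G_discrete_Rset_nbhd; apply: TT_cover_G_discrete => U sU.
  apply: G_finite_TT_cover => //.
  apply: (ultracopower_inj_G_finite R flowX edX) => S u.
  by have [_ [h [_ fh _]]] := isoX nat S u; exact: can_inj fh.
- by move=> compX; exists (SN R G) => //; exact: SN_seminorm_base.
- move=> [B baseB compB]; apply: Rset_nbhd_G_finite => //.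
  exact: compatible_Rset_nbhd compB.
Qed.
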